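(* Let $\beta\in(0,1)$, $x_0\in\mathbb{R}$, $p>\frac1\beta$ and $q=\frac{p}{p-1}$. Suppose $f:(0,+\infty)\times\mathbb{R}\to\mathbb{R}$ is a continuous function, and there exist a nonnegative function $l\in C(0,+\infty)$ with $t^{1-\beta}l(t)\in L^{p}_{Loc}[0,+\infty)$ and a nonnegative nondecreasing function $\omega\in C[0,+\infty)$ with $\lim_{t\to+\infty}\frac{t}{\omega(t)}=K$, where $0<K\le+\infty$, such that $$|f(t,x)|\le l(t)\,\omega(t^{1-\beta}|x|)$$ for all $(t,x)\in(0,+\infty)\times\mathbb{R}$. Then the fractional differential equation $$D_{r}^{\beta}x(t)=f(t,x(t)),\qquad \lim_{t\to0^{+}}t^{1-\beta}x(t)=x_{0},$$ has at least one global solution in $C_{1-\beta}(0,+\infty)$.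
   Context: $L^{p}_{Loc}[0,+\infty)$ denotes the functions belonging to $L^p[0,T]$ for every $T>0$. For $\alpha\in(0,1)$, $C_{\alpha}(0,+\infty)$ is the set of $x\in C(0,+\infty)$ such that $\lim_{t\to0^{+}}t^{\alpha}x(t)$ exists (as a finite real number). For $\beta\in(0,1)$, the Riemann-Liouville fractional integral is $I^{\beta}\varphi(t)=\frac{1}{\Gamma(\beta)}\int_{0}^{t}\frac{\varphi(s)}{(t-s)^{1-\beta}}\,ds$ for $\varphi\in L^1[0,T]$, and the Riemann-Liouville fractional derivative is $D_{r}^{\beta}\varphi(t)=\frac{d}{dt}I^{1-\beta}\varphi(t)=\frac{1}{\Gamma(1-\beta)}\frac{d}{dt}\int_{0}^{t}\frac{\varphi(s)}{(t-s)^{\beta}}\,ds$ for a.e. $t\in[0,T]$, where $I^{1-\beta}\varphi$ is required to be an absolutely continuous function (i.e. it agrees on $(0,T]$ with an absolutely continuous function on $[0,T]$). A global solution in $C_{1-\beta}(0,+\infty)$ is a function $x\in C_{1-\beta}(0,+\infty)$ such that, for every $T>0$, $I^{1-\beta}x$ is absolutely continuous on $[0,T]$ in this sense and $D_r^\beta x(t)=f(t,x(t))$ for a.e. $t\in(0,T]$, and such that $\lim_{t\to0^+}t^{1-\beta}x(t)=x_0$. *)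

(* Defs.v *)
From HB Require Import structures.
From mathcomp Require Import all_boot all_order all_algebra.
From mathcomp Require Import all_classical all_reals all_analysis.
Import Order.TTheory GRing.Theory Num.Theory.
Import numFieldNormedType.Exports.

Set Implicit Arguments.
Unset Strict Implicit.
Unset Printing Implicit Defensive.

Local Open Scope classical_set_scope.
Local Open Scope ring_scope.

(* Convention: a function defined on (0, +oo) or [0, +oo) is given by a total
   function R -> R whose values elsewhere are irrelevant. *)

(* The Euler integral; meaningful for 0 < a. *)
Definition Gamma {R : realType} (a : R) : R :=
  \int[lebesgue_measure]_(t in `]0, +oo[) (t `^ (a - 1) * expR (- t)).

Definition Lp_loc {R : realType} (p : R) (g : R -> R) : Prop :=
  forall T : R, 0 < T -> (g \_ `[0, T]) \in Lfun (@lebesgue_measure R) p%:E.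

Definition C_weighted {R : realType} (alpha : R) (x : R -> R) : Prop :=
  {within `]0, +oo[, continuous x} /\
  exists y : R, t `^ alpha * x t @[t --> 0^'+] --> y.

(* At s = t the integrand takes the junk value 0 (0 `^ (1 - beta) = 0 and
   0^-1 = 0), which does not affect the integral. *)
Definition RL_integral {R : realType} (beta : R) (phi : R -> R) (t : R) : R :=
  (Gamma beta)^-1 *
  \int[lebesgue_measure]_(s in `[0, t]) (phi s / (t - s) `^ (1 - beta)).

(* [derive1] returns a junk value where the derivative does not exist, so this
   is to be used together with [RL_derivable]. *)
Definition RL_derivative {R : realType} (beta : R) (phi : R -> R) (t : R) : R :=
  derive1 (RL_integral (1 - beta) phi) t.

Definition RL_derivable {R : realType} (beta : R) (phi : R -> R) (t : R) : Prop :=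
  derivable (RL_integral (1 - beta) phi) t 1.

Definition absolutely_continuous {R : realType} (a b : R) (g : R -> R) : Prop :=
  forall e : R, 0 < e -> exists2 d : R, 0 < d &
  forall (n : nat) (u v : 'I_n -> R),
    (forall i, a <= u i /\ u i <= v i /\ v i <= b) ->
    trivIset setT (fun i => `]u i, v i[%classic) ->
    \sum_(i < n) (v i - u i) < d ->
    \sum_(i < n) `|g (v i) - g (u i)| < e.

(* The restriction to (0, T] matters: the formula gives 0 at t = 0, whereas for
   phi t = t `^ (- beta) the integral of order beta is a nonzero constant on
   (0, T]. *)
Definition RL_integral_AC {R : realType} (beta : R) (phi : R -> R) (T : R) : Prop :=
  exists2 g : R -> R, absolutely_continuous 0 T g &
  forall t : R, 0 < t <= T -> RL_integral beta phi t = g t.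

Definition global_solution {R : realType} (beta x0 : R) (f : R -> R -> R)
    (x : R -> R) : Prop :=
  [/\ C_weighted (1 - beta) x,
      (forall T : R, 0 < T ->
         RL_integral_AC (1 - beta) x T /\
         {ae (@lebesgue_measure R), forall t : R, 0 < t <= T ->
            RL_derivable beta x t /\ RL_derivative beta x t = f t (x t)}) &
      t `^ (1 - beta) * x t @[t --> 0^'+] --> x0].

(* Main.v *)
(* With a = 1 - beta and u(t) = t^a x(t), the problem becomes the Volterra equation
   u(t) = x0 + c int_0^t (t/(t-s))^a F(s, u(s)) ds, where F(s, v) = f(s, s^(-a) v) and,
   by the linear growth of omega, |F(s, v)| <= L(s) (1 + |v|) with L a multiple of l.
   Splitting at s = t/2 and using Young's inequality
   (t-s)^(-a) h(s) <= (t-s)^(-aq) + h(s)^p with h(s) = s^a L(s), a q < 1, one sees that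
   the integrals of the kernel times L over (t - eta, t) tend to 0 with eta, uniformly
   for bounded t.  This single fact yields an a priori bound M exp(lambda t) for the
   Tonelli (delayed) approximations, without Gronwall, as well as their
   equicontinuity; Ascoli's theorem and dominated convergence then give a solution u.
   Finally, by Fubini and int_s^t (r-s)^(-a) (t-r)^(-beta) dr = B, where
   B = int_0^1 r^(-a) (1-r)^(-beta) dr, the fractional integral of order a of
   x(t) = t^(-a) u(t) is a constant plus int_0^t f(s, x(s)) ds.  Choosing
   c = Gamma(a) / B makes the identity B = Gamma(a) Gamma(beta) unnecessary. *)
Require Import Defs.
From HB Require Import structures.
From mathcomp Require Import all_boot all_order all_algebra.
From mathcomp Require Import all_classical all_reals all_analysis.
From mathcomp Require Import measurable_realfun ring lra.
Import Order.TTheory GRing.Theory Num.Theory.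
Import numFieldNormedType.Exports.

Set Implicit Arguments.
Unset Strict Implicit.

Local Open Scope classical_set_scope.
Local Open Scope ring_scope.

(** * Compactness of equicontinuous sequences of real functions *)

Section ascoli_sequences.
Context {R : realType}.

(** Ascoli's theorem gives a cluster point [u] of the sequence for uniform convergence on compact
    sets. Choosing an index [phi j >= j] at which the distance to [u] on [[-j, j]] is below
    [1/(j+1)] turns it into a pointwise limit. Monotonicity of [phi] is not claimed: [j <= phi j] is
    enough to pass to the limit. *)
Lemma Ascoli_subsequence (y : nat -> R -> R) :
  (forall x : R, exists M : R, forall n, `|y n x| <= M) ->
  (forall x e : R, 0 < e -> \forall z \near x, forall n, `|y n x - y n z| < e) ->
  exists (phi : nat -> nat) (u : R -> R),
    (forall j, (j <= phi j)%N) /\ forall x, y (phi j) x @[j --> \oo] --> u x.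
Proof.
move=> ybnd yeq.
pose W : set (R -> R) := range y.
have pW : pointwise_precompact W id.
  move=> x; have [M yM] := ybnd x.
  apply: (@precompact_subset _ _ `[- M, M]%classic).
    by move=> z /= [_ [n _ <-] <-] /=; rewrite in_itv/= -ler_norml.
  rewrite precompact_closed; last exact: itv_closed.
  exact: segment_compact.
have eW : equicontinuous W id.
  move=> x E; rewrite -entourage_from_ballE => -[e /= e0 eE].
  apply: filterS (yeq x e e0) => z yz _ [n _ <-]; apply: eE => /=.
  exact: yz.
have := pointwise_precompact_equicontinuous pW eW.
rewrite precompactE => /(_ (@Rhausdorff R))/(_ (y @ \oo) _ _)[].
  by exists 0%N => // n _; apply: subset_closure; exists n.
move=> u [_ uy].
have near_u j : exists n, (j <= n)%N /\
    forall x, `[- j%:R, j%:R]%classic x -> `|u x - y n x| < j.+1%:R^-1.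
  pose E : set (R * R) := [set z | ball z.1 j.+1%:R^-1 z.2].
  have entE : entourage E by apply: (entourage_ball R (PosNum _)); rewrite invr_gt0.
  have := @fam_nbhs _ _ compact _ E u entE (@segment_compact R (- j%:R) j%:R).
  have yj : (y @ \oo) [set y n | n in [set n | (j <= n)%N]].
    by exists j => // n /= jn; exists n.
  move=> /(uy _ _ yj)[_ [[n /= jn <-] un]].
  by exists n; split => // x xj; exact: un.
have [phi phiP] := choice near_u.
exists phi, u; split=> [j|x]; first by have [] := phiP j.
apply/(@cvgrPdist_lt _ R^o) => e e0.
near=> j.
have [_ /(_ x)] := phiP j.
rewrite /= in_itv/= -ler_norml => /(_ _)/lt_trans; apply.
  near: j; exact: nbhs_infty_ger.
near: j.
exact: (near_infty_natSinv_lt (PosNum e0)).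
Unshelve. all: end_near. Qed.

End ascoli_sequences.

(** * Real-valued forms of domination and dominated convergence *)

Section real_integrals.
Context {R : realType}.
Notation mu := (@lebesgue_measure R).
Implicit Types f g : R -> R.

Lemma dominated_integrable_real f g : measurable_fun setT f ->
  (forall x, `|f x| <= g x) -> mu.-integrable setT (EFin \o g) ->
  mu.-integrable setT (EFin \o f).
Proof.
move=> mf fg; apply: le_integrable => //; first exact/measurable_EFinP.
by move=> x _ /=; rewrite lee_fin (le_trans (fg x))// ler_norm.
Qed.

Lemma norm_Rintegral_dominated f g : measurable_fun setT f ->
  (forall x, `|f x| <= g x) -> mu.-integrable setT (EFin \o g) ->
  `|\int[mu]_x f x| <= \int[mu]_x g x.
Proof.
move=> mf fg ig; have intf := dominated_integrable_real mf fg ig.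
apply: (le_trans (le_normr_Rintegral _ intf)) => //.
by apply: le_Rintegral => //; exact: integrable_norm.
Qed.

(** The null set [N] serves truncated kernels, which jump in [t] at a single value of [s]. *)
Lemma Rdominated_convergence (N : set R) (f_ : nat -> R -> R) f g :
  measurable N -> mu N = 0%E ->
  (forall n, measurable_fun setT (f_ n)) -> measurable_fun setT f ->
  (forall x, ~ N x -> f_ n x @[n --> \oo] --> f x) ->
  mu.-integrable setT (EFin \o g) -> (forall n x, `|f_ n x| <= g x) ->
  \int[mu]_x f_ n x @[n --> \oo] --> \int[mu]_x f x.
Proof.
move=> mN N0 mf_ mf ff ig fg.
have [] := @dominated_convergence _ (measurableTypeR R) _ mu setT measurableT
  (fun n => EFin \o f_ n) (EFin \o f) (EFin \o g).
- by move=> n /=; apply/measurable_EFinP; exact: mf_.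
- exact/measurable_EFinP.
- exists N; split => // x /= nfx; apply: contrapT => Nx; apply: nfx => _.
  by apply: cvg_EFin; [exact: nearW|exact: ff].
- exact: ig.
- exists set0; split => // x /= nfg; apply: nfg => n _.
  by rewrite lee_fin.
move=> intf _ /= fcvg; apply: fine_cvg.
by rewrite /Rintegral fineK//; exact: (integrable_fin_num _ intf).
Qed.

Lemma integrableD_real f g : mu.-integrable setT (EFin \o f) ->
  mu.-integrable setT (EFin \o g) ->
  mu.-integrable setT (EFin \o (fun x => f x + g x)).
Proof. by move=> intf intg; exact: (integrableD _ intf intg). Qed.

Lemma integrableZl_real (c : R) f : mu.-integrable setT (EFin \o f) ->
  mu.-integrable setT (EFin \o (fun x => c * f x)).
Proof. by move=> intf; exact: (integrableZl _ c intf). Qed.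

Lemma measurable_real_of_integrable f : mu.-integrable setT (EFin \o f) ->
  measurable_fun setT f.
Proof. by move=> /measurable_int/measurable_EFinP. Qed.

End real_integrals.

(** * Volterra equations whose kernel has uniformly small tails *)

Section volterra.
Context {R : realType} (k : R -> R -> R) (L : R -> R).
Notation mu := (@lebesgue_measure R).
Notation integrable f := (mu.-integrable setT (EFin \o f)).

(** These hypotheses isolate what is used of the singular kernel. The quantitative one is [kL_tail]:
    the mass near the diagonal is small uniformly in [t <= T]. By [k_supp] the kernel vanishes for
    [t <= 0], so all functions live on the whole line and bounds are stated on half-lines
    [t <= T]. *)
Hypothesis k_ge0 : forall t s : R, 0 <= k t s.
Hypothesis k_supp : forall t s : R, ~~ (0 < s < t) -> k t s = 0.
Hypothesis k_meas : forall t, measurable_fun setT (k t).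
Hypothesis k_bound : forall T eta : R, 0 < eta ->
  exists M : R, forall t s : R, t <= T -> s <= t - eta -> k t s <= M.
Hypothesis k_cont : forall t0 s, s != t0 -> k t s @[t --> t0] --> k t0 s.
Hypothesis L_ge0 : forall s, 0 <= L s.
Hypothesis L_int : forall T : R, integrable (fun s => if s <= T then L s else 0).
Hypothesis L_meas : measurable_fun setT L.
Hypothesis kL_int : forall t, integrable (fun s => k t s * L s).
Hypothesis kL_tail : forall T e : R, 0 < e -> exists2 eta : R, 0 < eta &
  forall t : R, t <= T -> \int[mu]_s (if t - eta < s then k t s * L s else 0) <= e.

Lemma measurable_fun_lt (t : R) : measurable_fun setT (fun s : R => t < s).
Proof. exact: measurable_fun_ltr. Qed.

Lemma measurable_fun_le (t : R) : measurable_fun setT (fun s : R => s <= t).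
Proof. exact: measurable_fun_ler. Qed.

Lemma kdiff_int t t0 : integrable (fun s => `|k t s - k t0 s| * L s).
Proof.
apply: (@dominated_integrable_real _ _ (fun s => k t s * L s + k t0 s * L s)).
- apply: measurable_funM => //; apply: measurableT_comp => //.
  exact: measurable_funB.
- move=> s; rewrite normrM normr_id (ger0_norm (L_ge0 s)) -mulrDl ler_wpM2r//.
  by rewrite (le_trans (ler_normB _ _))// !ger0_norm.
- exact: integrableD_real.
Qed.

(** The kernel without its singular part; [k_bound] makes it bounded for [t <= T], so dominated
    convergence applies to it. *)
Let cut (eta t s : R) : R := if s <= t - eta then k t s else 0.

Let cut_meas (eta t : R) : measurable_fun setT (cut eta t).
Proof. by apply: measurable_fun_ifT => //; exact: measurable_fun_le. Qed.

(** For [t] near [t0] the truncation condition keeps its truth value, except when [s] is the jump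
    point [t0 - eta]. *)
Let cut_cvg (eta t0 s : R) : 0 < eta -> s != t0 - eta ->
  cut eta t s @[t --> t0] --> cut eta t0 s.
Proof.
move=> eta0 st; have [st0|] := ltP s (t0 - eta); last first.
  rewrite le_eqVlt eq_sym (negbTE st)/= => st0.
  have -> : cut eta t0 s = 0 by rewrite /cut leNgt st0.
  apply: (@cvg_near_cst R R); near=> t; rewrite /cut leNgt.
  suff -> : t - eta < s by [].
  by rewrite ltrBlDr; near: t; apply: lt_nbhsl; rewrite -ltrBlDr.
have -> : cut eta t0 s = k t0 s by rewrite /cut ltW.
have kt0 : k t s @[t --> t0] --> k t0 s by apply: k_cont; rewrite lt_eqF//; lra.
apply: cvg_trans kt0; apply: near_eq_cvg; near=> t; rewrite /cut.
suff -> : s <= t - eta by [].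
by rewrite lerBrDr; apply: ltW; near: t; apply: lt_nbhsr; rewrite -ltrBrDr.
Unshelve. all: end_near. Qed.

(** The difference splits into truncated kernels, whose contribution tends to 0 by dominated
    convergence, and two tails of width [eta], each at most [e / 4] by [kL_tail]. *)
Lemma kdiff_cvg t0 : \int[mu]_s (`|k t s - k t0 s| * L s) @[t --> t0] --> 0.
Proof.
apply: (@cvgrPdist_le _ R^o _ (nbhs t0) _ _ _).2 => e e0.
have e4 : 0 < e / 4 by lra.
have [eta eta0 tail] := kL_tail (t0 + 1) e4.
have [M kM] := k_bound (t0 + 1) eta0.
have M0 : 0 <= M.
  by rewrite (le_trans (k_ge0 t0 (t0 - eta)))// kM//; lra.
pose D (t s : R) := `|cut eta t s - cut eta t0 s| * L s.
have Dm t : measurable_fun setT (D t).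
  apply: measurable_funM => //; apply: measurableT_comp => //.
  exact: measurable_funB.
have cutM (t s : R) : t <= t0 + 1 -> 0 <= cut eta t s <= M * (s <= t0 + 1)%R%:R.
  rewrite /cut => tt0; case: ifPn => [st|_].
    have -> : s <= t0 + 1 by lra.
    by rewrite k_ge0/= mulr1 kM.
  by rewrite lexx mulr_ge0.
have Dbound (t s : R) : t <= t0 + 1 -> `|D t s| <= M * (if s <= t0 + 1 then L s else 0).
  move=> tt0; rewrite /D normrM normr_id (ger0_norm (L_ge0 s)).
  have t00 : t0 <= t0 + 1 by lra.
  have /andP[? ?] := cutM t s tt0; have /andP[? ?] := cutM t0 s t00.
  have -> : M * (if s <= t0 + 1 then L s else 0) = M * (s <= t0 + 1)%R%:R * L s.
    by case: ifP; rewrite ?(mulr1,mulr0,mul0r).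
  by apply: ler_wpM2r => //; rewrite ler_norml; apply/andP; split; lra.
(* Capping [t] at [t0 + 1] makes the domination hold along a whole sequence tending to [t0], not
   just eventually. *)
have Dcvg : \int[mu]_s D (Num.min t (t0 + 1)) s @[t --> t0] --> 0.
  have -> : 0 = \int[mu]_(s in setT) (0 : R) by rewrite /Rintegral integral0.
  apply/(@cvg_nbhsP _ R^o) => u ut0.
  apply: (@Rdominated_convergence _ [set t0 - eta] _ _
    (fun s => M * (if s <= t0 + 1 then L s else 0))) => //.
  - exact: lebesgue_measure_set1.
  - move=> s /= /eqP st.
    rewrite /D -[X in _ --> X](mul0r (L s)); apply: cvgM; last exact: cvg_cst.
    rewrite -(normr0 R^o) -(subrr (cut eta t0 s)).
    apply: (@cvg_norm _ R^o); apply: cvgB; last exact: cvg_cst.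
    have := cut_cvg eta0 st.
    move/(@cvg_nbhsP _ R^o); apply.
    have : {for t0, continuous ((id : R -> R^o) \min cst (t0 + 1))}.
      by apply: continuous_min; [exact: cvg_id|exact: cvg_cst].
    rewrite /prop_for /continuous_at /= min_l; last by rewrite lerDl.
    by move/(@cvg_nbhsP _ R^o); apply.
  - exact: integrableZl_real.
  - by move=> n s; apply: Dbound; rewrite ge_min lexx orbT.
have tail_int t : integrable (fun s => if t - eta < s then k t s * L s else 0).
  apply: (@dominated_integrable_real _ _ (fun s => k t s * L s)) => //.
  - apply: measurable_fun_ifT => //; first exact: measurable_fun_lt.
    exact: measurable_funM.
  - by move=> s; case: ifP => _; rewrite ?normr0 ?ger0_norm ?mulr_ge0.
have {}Dcvg := (@cvgrPdist_le _ R^o _ (nbhs t0) _ _ _).1 Dcvg _ e4.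
have t0T : \forall t \near t0, t < t0 + 1 by apply: lt_nbhsl; lra.
move: Dcvg => /(_ _) Dcvg; apply: filterS2 Dcvg t0T => t De /ltW tt0.
have t00 : t0 <= t0 + 1 by lra.
have Dint : integrable (D t).
  apply: (@dominated_integrable_real _ _
    (fun s => M * (if s <= t0 + 1 then L s else 0))) => //.
  - by move=> s; exact: Dbound.
  - exact: integrableZl_real.
have {}De : \int[mu]_s D t s <= e / 4.
  by move: De; rewrite min_l// sub0r normrN => /(le_trans (ler_norm _)).
rewrite sub0r normrN ger0_norm; last first.
  by apply: Rintegral_ge0 => s _; rewrite mulr_ge0.
have tt := tail t tt0; have tt' := tail t0 t00.
apply: (@le_trans _ _ (\int[mu]_s (D t s +
    ((if t - eta < s then k t s * L s else 0) +
     (if t0 - eta < s then k t0 s * L s else 0))))).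
  apply: le_Rintegral => //.
  - exact: kdiff_int.
  - by apply: integrableD_real => //; exact: integrableD_real.
  (* Each kernel value is either kept by its truncation or counted in its tail; the four cases
     follow. *)
  move=> s _; rewrite /D /cut (leNgt s (t - eta)) (leNgt s (t0 - eta)).
  have kt : `|k t s - k t0 s| * L s <= k t s * L s + k t0 s * L s.
    rewrite -mulrDl ler_wpM2r// (le_trans (ler_normB _ _))//.
    by rewrite !ger0_norm.
  case: (ltP (t - eta)) => _ /=; case: (ltP (t0 - eta)) => _ /=;
    rewrite ?subr0 ?sub0r ?normrN ?normr0 ?(ger0_norm (k_ge0 _ _)); lra.
rewrite RintegralD//; last exact: integrableD_real.
rewrite RintegralD//; lra.
Qed.

Definition volterra_op (g : R -> R) (t : R) : R := \int[mu]_s (k t s * g s).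

Lemma volterra_op_le0 (g : R -> R) (t : R) : t <= 0 -> volterra_op g t = 0.
Proof.
move=> t0; rewrite /volterra_op (_ : (fun s => _) = cst 0).
  by rewrite /Rintegral integral0.
apply/funext => s; rewrite k_supp ?mul0r//.
by apply/negP => /andP[s0 st]; move: (lt_le_trans st t0); rewrite ltNge (ltW s0).
Qed.

(** Nothing is known of [g] beyond [T], but there [k t s] vanishes because [t <= T]. *)
Lemma kg_bound (g : R -> R) (C T t s : R) : (forall s, s <= T -> `|g s| <= C * L s) ->
  t <= T -> `|k t s * g s| <= C * (k t s * L s).
Proof.
move=> gC tT; have [sT|Ts] := leP s T.
  by rewrite normrM ger0_norm// mulrCA ler_wpM2l// gC.
rewrite k_supp ?mul0r ?normr0 ?mulr0//.
by apply/negP => /andP[_ st]; move: (lt_le_trans st tT); rewrite ltNge (ltW Ts).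
Qed.

Lemma kg_int (g : R -> R) (C T t : R) : measurable_fun setT g ->
  (forall s, s <= T -> `|g s| <= C * L s) -> t <= T ->
  integrable (fun s => k t s * g s).
Proof.
move=> mg gC tT.
apply: (@dominated_integrable_real _ _ (fun s => C * (k t s * L s))).
- exact: measurable_funM.
- by move=> s; exact: kg_bound gC tT.
- exact: integrableZl_real.
Qed.

(** The modulus of continuity depends on [g] only through [C], hence it gives equicontinuity of a
    whole family as well as continuity of one image. *)
Lemma volterra_op_diff (g : R -> R) (C T t t0 : R) : measurable_fun setT g ->
  (forall s, s <= T -> `|g s| <= C * L s) -> t <= T -> t0 <= T ->
  `|volterra_op g t - volterra_op g t0| <=
  C * \int[mu]_s (`|k t s - k t0 s| * L s).
Proof.
move=> mg gC tT t0T; rewrite /volterra_op -RintegralB//; first last.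
- exact: kg_int gC t0T.
- exact: kg_int gC tT.
rewrite -RintegralZl//; last exact: kdiff_int.
apply: norm_Rintegral_dominated.
- by apply: measurable_funB; exact: measurable_funM.
- move=> s; rewrite -mulrBl normrM.
  have [sT|Ts] := leP s T; first by rewrite mulrCA ler_wpM2l// gC.
  have k0 t' : t' <= T -> k t' s = 0.
    move=> t'T; apply: k_supp; apply/negP => /andP[_ st].
    by move: (lt_le_trans st t'T); rewrite ltNge (ltW Ts).
  by rewrite !k0// subrr normr0 !mul0r mulr0.
- by apply: integrableZl_real; exact: kdiff_int.
Qed.

Lemma volterra_op_continuous (g : R -> R) : measurable_fun setT g ->
  (forall T : R, exists C : R, forall s, s <= T -> `|g s| <= C * L s) ->
  continuous (volterra_op g).
Proof.
move=> mg gC t0; have [C gCT] := gC (t0 + 1).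
apply/(@cvgrPdist_le _ R^o) => /= e e0.
(* The constant [C] may be zero or negative, so [e] is divided by [|C| + 1]. *)
have C0 : 0 < `|C| + 1 by rewrite ltr_wpDl.
have eC : 0 < e / (`|C| + 1) by rewrite divr_gt0.
have := (@cvgrPdist_le _ R^o _ (nbhs t0) _ _ _).1 (kdiff_cvg t0) _ eC.
have t0T : \forall t \near t0, t < t0 + 1 by apply: lt_nbhsl; lra.
move=> /(_ _) kd; apply: filterS2 kd t0T => t + /ltW tt0.
rewrite sub0r normrN => kd; rewrite distrC.
have t00 : t0 <= t0 + 1 by lra.
apply: (le_trans (volterra_op_diff mg gCT tt0 t00)).
set I := (X in C * X); rewrite -/I in kd.
apply: (@le_trans _ _ ((`|C| + 1) * `|I|)).
  rewrite (le_trans (ler_norm _))// normrM ler_wpM2r// lerDl//.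
by rewrite mulrC -ler_pdivlMr.
Qed.

Lemma kL_exp_int (lambda t : R) : 0 <= lambda ->
  integrable (fun s => k t s * (L s * expR (lambda * s))).
Proof.
move=> l0; apply: (@kg_int _ (expR (lambda * t)) t t) => //.
- apply: measurable_funM => //.
  by apply: measurableT_comp; [exact: measurable_expR|exact: mulrl_measurable].
- move=> s st; rewrite ger0_norm ?mulr_ge0 ?expR_ge0// mulrC ler_wpM2r//.
  by rewrite ler_expR ler_wpM2l.
Qed.

(** The factor 1/4 is two eighths. On the tail [t - eta < s] the weight is at most
    [expR (lambda * t)] and [kL_tail] gives 1/8. For [s <= t - eta] the kernel is at most [M], while
    the weight gains [expR (- (lambda * eta))], which a large [lambda] makes small. *)
Lemma kL_exp (T : R) : exists2 lambda : R, 0 <= lambda & forall t : R, t <= T ->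
  \int[mu]_s (k t s * (L s * expR (lambda * s))) <= expR (lambda * t) / 4.
Proof.
have e0 : (0 : R) < 1 / 8 by lra.
have [eta eta0 tail] := kL_tail T e0.
have [M kM] := k_bound T eta0.
have M0 : 0 <= M.
  by rewrite (le_trans (k_ge0 T (T - eta)))// kM//.
pose I := \int[mu]_s (if s <= T then L s else 0).
have I0 : 0 <= I by apply: Rintegral_ge0 => s _; case: ifP.
(* Then [lambda * eta = 8 * M * I], and [1 + x <= expR x] yields
   [M * I * expR (- (lambda * eta)) <= 1 / 8]. *)
pose lambda := 8 * M * I / eta.
have l0 : 0 <= lambda by rewrite !mulr_ge0// invr_ge0 ltW.
exists lambda => // t tT.
pose E := expR (lambda * t).
have E0 : 0 < E by exact: expR_gt0.
have expl : M * I * expR (- (lambda * eta)) <= 1 / 8.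
  rewrite expRN ler_pdivrMr ?expR_gt0//.
  have := expR_ge1Dx (lambda * eta).
  rewrite {1}/lambda divfK ?gt_eqF//; lra.
have tail_int : integrable (fun s => if t - eta < s then k t s * L s else 0).
  apply: (@dominated_integrable_real _ _ (fun s => k t s * L s)) => //.
  - apply: measurable_fun_ifT => //; first exact: measurable_fun_lt.
    exact: measurable_funM.
  - by move=> s; case: ifP => _; rewrite ?normr0 ?ger0_norm ?mulr_ge0.
apply: (@le_trans _ _ (\int[mu]_s
   (M * expR (- (lambda * eta)) * E * (if s <= T then L s else 0) +
    E * (if t - eta < s then k t s * L s else 0)))).
  apply: le_Rintegral => //.
  - exact: kL_exp_int.
  - by apply: integrableD_real; exact: integrableZl_real.
  move=> s _; have [st|] := leP t s.
    have -> : k t s = 0 by apply: k_supp; rewrite [s < t]ltNge st andbF.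
    by rewrite !mul0r addr_ge0// mulr_ge0 ?mulr_ge0 ?expR_ge0 ?(ltW E0)//;
      case: ifP.
  move=> st; have sT : s <= T by rewrite (le_trans (ltW st)).
  rewrite sT; have [ts|st'] := ltP (t - eta) s.
    apply: (@le_trans _ _ (E * (k t s * L s))).
      rewrite mulrA mulrC ler_wpM2r ?mulr_ge0// ler_expR ler_wpM2l//.
      exact: ltW.
    by rewrite lerDr !mulr_ge0 ?expR_ge0// ltW.
  have -> : M * expR (- (lambda * eta)) * E = M * expR (lambda * (t - eta)).
    by rewrite -mulrA -expRD; congr (_ * expR _); ring.
  rewrite mulr0 addr0 mulrCA [leRHS]mulrC ler_wpM2l// ler_pM ?expR_ge0 ?kM//.
  by rewrite ler_expR ler_wpM2l.
rewrite RintegralD//; last 2 first.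
- exact: integrableZl_real.
- exact: integrableZl_real.
rewrite !RintegralZl//.
have tailE := ler_wpM2l (ltW E0) (tail t tT).
have explE := ler_wpM2l (ltW E0) expl.
rewrite -/I -/E; lra.
Qed.

(** * Tonelli approximations and passage to the limit *)

Section tonelli.
Context (F : R -> R -> R) (x0 : R).
Hypothesis F_cont : forall s, continuous (F s).
Hypothesis F_meas : forall u : R -> R, continuous u ->
  measurable_fun setT (fun s => F s (u s)).
Hypothesis F_bound : forall s x : R, `|F s x| <= L s * (1 + `|x|).

Definition delayed_op (delta : R) (u : R -> R) (t : R) : R :=
  x0 + volterra_op (fun s => F s (u (s - delta))) t.

(** The word [above] refers to the variable [t]: [u] is bounded in absolute value on each half-line
    ending at [T]. *)
Definition locally_bounded_above (u : R -> R) : Prop :=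
  forall T : R, exists M : R, forall t : R, t <= T -> `|u t| <= M.

Lemma continuous_delay (u : R -> R) (delta : R) : continuous u ->
  continuous (fun s => u (s - delta)).
Proof.
move=> cu s; apply: (@continuous_comp _ _ _ (fun s => s - delta) u); last exact: cu.
by apply: (@cvgB _ R^o); [exact: cvg_id|exact: cvg_cst].
Qed.

Lemma F_delay_bound (u : R -> R) (delta M T : R) : 0 <= delta ->
  (forall t, t <= T -> `|u t| <= M) ->
  forall s, s <= T -> `|F s (u (s - delta))| <= (1 + M) * L s.
Proof.
move=> d0 uM s sT; rewrite (le_trans (F_bound _ _))// mulrC ler_wpM2r// lerD2l.
by apply: uM; rewrite (le_trans _ sT)// lerBlDr lerDl.
Qed.

Lemma delayed_op_continuous (delta : R) (u : R -> R) : 0 <= delta ->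
  continuous u -> locally_bounded_above u -> continuous (delayed_op delta u).
Proof.
move=> d0 cu bu t; apply: (@cvgD _ R^o); first exact: cvg_cst.
apply: volterra_op_continuous.
- by apply: (F_meas (u := fun s => u (s - delta))); exact: continuous_delay.
- move=> T; have [M uM] := bu T; exists (1 + M) => s.
  exact: F_delay_bound.
Qed.

(** An invariant region common to all delays: it contains the initial iterate [cst x0], and every
    [delayed_op delta] maps its continuous members into it. The resulting bounds are therefore
    uniform in the delay and in the number of iterations. *)
Definition barrier (T : R) (Phi : R -> R) : Prop :=
  [/\ exists M : R, forall t : R, t <= T -> Phi t <= M,
      forall t : R, `|x0| <= Phi t &
      forall (delta : R) (u : R -> R), 0 <= delta -> continuous u ->
        (forall t : R, t <= T -> `|u t| <= Phi t) ->
        forall t : R, t <= T -> `|delayed_op delta u t| <= Phi t].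

(* [Phi t = M * exp (lambda * max 0 t)], with [lambda] so large that the exponential
   weight absorbs the part of the kernel away from its singularity. *)
Lemma barrier_exists (T : R) : exists Phi : R -> R, barrier T Phi.
Proof.
have [lambda l0 kLe] := kL_exp T.
(* Since [M >= 1], one has [1 + |u| <= 2 * M * expR (lambda * s)], so the factor 1/4 of [kL_exp]
   leaves half of [Phi t] for the integral; [M >= 2 * |x0|] makes [|x0|] fit into the other half. *)
pose M := 1 + 2 * `|x0|.
have x0M : 2 * `|x0| <= M by rewrite /M lerDr.
have M1 : 1 <= M by rewrite /M lerDl mulr_ge0.
have M0 : 0 <= M by lra.
have exp1 (t : R) : 0 <= t -> 1 <= expR (lambda * t).
  by move=> t0; rewrite -[leLHS]expR0 ler_expR mulr_ge0.
pose Phi (t : R) := M * expR (lambda * Num.max 0 t).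
have Phi_mono : {homo Phi : s t / s <= t}.
  move=> s t st; rewrite ler_wpM2l// ler_expR ler_wpM2l//.
  by rewrite ge_max !le_max lexx st orbT.
have x0Phi t : `|x0| <= Phi t.
  apply: (@le_trans _ _ M); first by have := normr_ge0 x0; lra.
  by rewrite ler_peMr// exp1// le_max lexx.
exists Phi; split=> //.
  by exists (Phi T) => t; exact: Phi_mono.
move=> delta u d0 cu uPhi t tT.
have [t0|t0] := leP t 0; first by rewrite /delayed_op volterra_op_le0// addr0.
rewrite /delayed_op (le_trans (ler_normD _ _))//.
have -> : Phi t = M * expR (lambda * t) by rewrite /Phi max_r// ltW.
have volt_le : `|volterra_op (fun s => F s (u (s - delta))) t| <=
    2 * M * (expR (lambda * t) / 4).
  apply: (@le_trans _ _
    (\int[mu]_s (2 * M * (k t s * (L s * expR (lambda * s)))))).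
    apply: norm_Rintegral_dominated.
    - apply: measurable_funM => //.
      by apply: (F_meas (u := fun s => u (s - delta))); exact: continuous_delay.
    - move=> s; have [/andP[s0 st]|st] := boolP (0 < s < t); last first.
        by rewrite k_supp// !mul0r normr0 mulr0.
      rewrite normrM ger0_norm// mulrCA ler_wpM2l// mulrCA.
      rewrite (le_trans (F_bound _ _))// ler_wpM2l//.
      have usd : `|u (s - delta)| <= M * expR (lambda * s).
        have sdT : s - delta <= T by lra.
        apply: (le_trans (uPhi _ sdT)).
        have -> : M * expR (lambda * s) = Phi s by rewrite /Phi max_r// ltW.
        by apply: Phi_mono; lra.
      have := mulr_ege1 M1 (exp1 _ (ltW s0)); lra.
    - by apply: integrableZl_real; exact: kL_exp_int.
  rewrite RintegralZl//; last exact: kL_exp_int.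
  by rewrite ler_wpM2l ?mulr_ge0// kLe.
have := ler_peMr M0 (exp1 _ (ltW t0)); lra.
Qed.

Definition tonelli_iter (delta : R) (n : nat) : R -> R :=
  iter n (delayed_op delta) (cst x0).

(** Continuity and bounds go in one induction: invariance of a barrier asks for a continuous
    argument, and continuity of the next iterate asks for a bound on the present one. *)
Lemma tonelli_iter_bounded (delta : R) (n : nat) : 0 <= delta ->
  continuous (tonelli_iter delta n) /\
  forall (T : R) (Phi : R -> R), barrier T Phi ->
    forall t, t <= T -> `|tonelli_iter delta n t| <= Phi t.
Proof.
move=> d0; elim: n => [|n [cn bn]] /=.
  by split => [|T Phi [_ x0Phi _] t _]; [exact: cst_continuous|exact: x0Phi].
split.
  apply: delayed_op_continuous => // T.
  have [Phi bPhi] := barrier_exists T; have [[M PhiM] _ _] := bPhi.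
  by exists M => t tT; rewrite (le_trans (bn _ _ bPhi t tT))// PhiM.
by move=> T Phi bPhi; have [_ _ step] := bPhi; apply: step => //; exact: bn.
Qed.

(* With the delay, an iterate at time [t] only depends on the previous one up to
   time [t - delta]. *)
Lemma tonelli_iter_stable (delta : R) (n : nat) (t : R) : t <= n%:R * delta ->
  tonelli_iter delta n.+1 t = tonelli_iter delta n t.
Proof.
elim: n t => [|n IH] t tn.
  by rewrite /= /delayed_op volterra_op_le0 ?addr0//; rewrite mul0r in tn.
rewrite [LHS]/= [RHS]/= /delayed_op; congr (_ + _).
apply: eq_Rintegral => s _.
have [/andP[s0 st]|st] := boolP (0 < s < t); last by rewrite k_supp// !mul0r.
by congr (_ * F s _); apply: IH; rewrite mulrSr mulrDl mul1r in tn; lra.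
Qed.

Let delay (n : nat) : R := n.+1%:R^-1.

Let delay_ge0 n : 0 <= delay n. Proof. by rewrite invr_ge0. Qed.

(** With delay [1/(n+1)], this many iterations reach stability up to time [n + 1 + 1/(n+1)], which
    covers [t <= n]. The outermost iteration shows [approx n] as a [delayed_op] on the whole line,
    which is what equicontinuity uses. *)
Let approx (n : nat) : R -> R := tonelli_iter (delay n) (n.+1 * n.+1).+1.

Let approx_eq (n : nat) (t : R) : t <= n%:R ->
  approx n t = delayed_op (delay n) (approx n) t.
Proof.
move=> tn; rewrite -[RHS]/(tonelli_iter _ (n.+1 * n.+1).+2 t).
rewrite tonelli_iter_stable//.
have -> : (n.+1 * n.+1).+1%:R * delay n = n.+1%:R + delay n.
  by rewrite -[_.+1]addn1 natrD natrM mulrDl mul1r mulfK// pnatr_eq0.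
by rewrite (le_trans tn)// ler_wpDr// ler_nat.
Qed.

Let approx_continuous n : continuous (approx n).
Proof. by have [] := tonelli_iter_bounded (n.+1 * n.+1).+1 (delay_ge0 n). Qed.

Let approx_bounded (T : R) :
  exists M : R, forall n t, t <= T -> `|approx n t| <= M.
Proof.
have [Phi bPhi] := barrier_exists T; have [[M PhiM] _ _] := bPhi.
exists M => n t tT; have [_ b] := tonelli_iter_bounded (n.+1 * n.+1).+1 (delay_ge0 n).
exact: le_trans (b _ _ bPhi t tT) (PhiM t tT).
Qed.

(** Each [approx n] is the image of an iterate lying under the barrier for [x + 1], so
    [volterra_op_diff] applies with the constant [1 + M] for every [n]. *)
Let approx_equicontinuous (x e : R) : 0 < e ->
  \forall z \near x, forall n, `|approx n x - approx n z| < e.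
Proof.
move=> e0.
have [Phi bPhi] := barrier_exists (x + 1); have [[M PhiM] x0Phi _] := bPhi.
have M0 : 0 <= M.
  by rewrite (le_trans (normr_ge0 x0))// (le_trans (x0Phi x))// PhiM//; lra.
(* The denominator [2 + M] exceeds the constant [1 + M], which makes the final inequality strict. *)
have eC : 0 < e / (2 + M) by rewrite divr_gt0//; lra.
have := (@cvgrPdist_le _ R^o _ (nbhs x) _ _ _).1 (kdiff_cvg x) _ eC.
have xT : \forall t \near x, t < x + 1 by apply: lt_nbhsl; lra.
move=> /(_ _) kd; apply: filterS2 kd xT => z + /ltW zT n.
rewrite sub0r normrN => kd.
have xT : x <= x + 1 by lra.
have [cn bn] := tonelli_iter_bounded (n.+1 * n.+1) (delay_ge0 n).
rewrite distrC /approx /= /delayed_op opprD addrACA subrr add0r.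
have bound : forall s, s <= x + 1 ->
    `|F s (tonelli_iter (delay n) (n.+1 * n.+1) (s - delay n))| <= (1 + M) * L s.
  apply: F_delay_bound => // t tT.
  exact: le_trans (bn _ _ bPhi t tT) (PhiM t tT).
have mF : measurable_fun setT
    (fun s => F s (tonelli_iter (delay n) (n.+1 * n.+1) (s - delay n))).
  apply: (F_meas (u := fun s => tonelli_iter (delay n) (n.+1 * n.+1) (s - delay n))).
  exact: continuous_delay.
apply: (le_lt_trans (volterra_op_diff mF bound zT xT)).
set I := (X in _ * X); rewrite -/I in kd.
have {}kd := le_trans (ler_norm _) kd.
apply: (@le_lt_trans _ _ ((1 + M) * (e / (2 + M)))).
  by rewrite ler_wpM2l//; lra.
rewrite mulrCA -[ltRHS]mulr1 ltr_pM2l// ltr_pdivrMr; lra.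
Qed.

(** Along the Ascoli subsequence the delay disappears by equicontinuity, and dominated convergence
    carries the delayed equation to the limit. *)
Lemma volterra_solution : exists u : R -> R,
  [/\ continuous u, locally_bounded_above u &
      forall t : R, u t = x0 + volterra_op (fun s => F s (u s)) t].
Proof.
have ybnd x : exists M : R, forall n, `|approx n x| <= M.
  by have [M b] := approx_bounded x; exists M => n; exact: b.
have [phi [u [phij yu]]] := Ascoli_subsequence ybnd approx_equicontinuous.
have ubnd : locally_bounded_above u.
  move=> T; have [M b] := approx_bounded T; exists M => t tT.
  apply: (cvgr_to_le (@cvg_norm _ R^o _ _ _ _ _ (yu t))).
  by apply: nearW => j; exact: b.
have delay0 : delay (phi j) @[j --> \oo] --> (0 : R).
  apply/(@cvgrPdist_lt _ R^o) => e e0; near=> j.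
  rewrite sub0r normrN ger0_norm//.
  apply: (@le_lt_trans _ _ j.+1%:R^-1).
    by rewrite lef_pV2 ?posrE// ler_nat ltnS.
  near: j; exact: (near_infty_natSinv_lt (PosNum e0)).
have shift_cvg s : approx (phi j) (s - delay (phi j)) @[j --> \oo] --> u s.
  apply/(@cvgrPdist_lt _ R^o) => e e0; have e2 : 0 < e / 2 by lra.
  have /(@cvgrPdist_lt _ R^o) /(_ _ e2) yus := yu s.
  have sd : s - delay (phi j) @[j --> \oo] --> s.
    by rewrite -[X in _ --> X]subr0; apply: (@cvgB _ R^o) => //; exact: cvg_cst.
  have yeq := sd _ (approx_equicontinuous s e2).
  apply: filterS2 yus yeq => j y1 /(_ (phi j)) y2.
  rewrite -(subrKA (approx (phi j) s)) (le_lt_trans (ler_normD _ _))//; lra.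
pose g (j : nat) s := F s (approx (phi j) (s - delay (phi j))).
have mg j : measurable_fun setT (g j).
  apply: (F_meas (u := fun s => approx (phi j) (s - delay (phi j)))).
  exact: continuous_delay.
have gcvg s : g j s @[j --> \oo] --> F s (u s).
  by apply: (@continuous_cvg _ _ _ _ _ _ (F s)); [exact: F_cont|exact: shift_cvg].
(* Continuity of [u] is not yet available for [F_meas]; measurability comes from the pointwise
   limit. *)
have mFu : measurable_fun setT (fun s => F s (u s)).
  by apply: (@measurable_fun_cvg _ _ _ setT g) => // s _; exact: gcvg.
have ueq t : u t = x0 + volterra_op (fun s => F s (u s)) t.
  apply: (@cvg_unique _ (@Rhausdorff R) (approx (phi j) t @[j --> \oo])).
    exact: yu.
  have yE : {near \oo, (fun j => x0 + volterra_op (g j) t) =1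
                       (fun j => approx (phi j) t)}.
    (* The delayed equation holds at [t] once [j >= t], because [phi j >= j]. *)
    near=> j; rewrite approx_eq//.
    by rewrite (@le_trans _ _ j%:R)// ?ler_nat//; near: j; exact: nbhs_infty_ger.
  apply: cvg_trans (near_eq_cvg yE) _.
  apply: (@cvgD _ R^o); first exact: cvg_cst.
  have [M b] := approx_bounded t.
  apply: (@Rdominated_convergence _ set0 _ _
    (fun s => (1 + M) * (k t s * L s))) => //.
  - by move=> j; exact: measurable_funM.
  - exact: measurable_funM.
  - by move=> s _; apply: cvgM; [exact: cvg_cst|exact: gcvg].
  - exact: integrableZl_real.
  - move=> j s; apply: (@kg_bound _ _ t) => // s' s't.
    by apply: (F_delay_bound (T := t)) => // t' t't; exact: b.
exists u; split => //.
(* Continuity of [u] is read off from the equation that it satisfies. *)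
have -> : u = fun t => x0 + volterra_op (fun s => F s (u s)) t by exact/funext.
move=> t; apply: (@cvgD _ R^o); first exact: cvg_cst.
apply: volterra_op_continuous => // T; have [M uM] := ubnd T.
exists (1 + M) => s sT; rewrite (le_trans (F_bound _ _))// mulrC ler_wpM2r//.
by rewrite lerD2l uM.
Unshelve. all: end_near. Qed.

End tonelli.

End volterra.

(** * The kernel (t / (t - s))^a and power singularities *)

Section affine_change_of_variable.
Context {R : realType}.
Notation mu := (@lebesgue_measure R).
Local Open Scope ereal_scope.

(** The pushforward of Lebesgue measure under [a * x + b], scaled by [|a|], has the right value on
    half-open intervals, hence equals Lebesgue measure by uniqueness. For [a < 0] preimages of
    intervals are closed on the other side. *)
Lemma ge0_integral_affine (f : R -> \bar R) (a b : R) : a != 0%R ->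
  measurable_fun setT f -> (forall x, 0 <= f x) ->
  \int[mu]_x f x = (`|a|)%:E * \int[mu]_x f (a * x + b)%R.
Proof.
move=> a0 mf f0.
pose phi : measurableTypeR R -> measurableTypeR R := fun x : R => (a * x + b)%R.
have mphi : measurable_fun [set: measurableTypeR R] phi.
  by apply: measurable_funD => //; exact: mulrl_measurable.
unshelve epose (pm := (pushforward mu phi : {measure set (measurableTypeR R) -> \bar R})).
  exact: mphi.
pose nu : {measure set (measurableTypeR R) -> \bar R} :=
  mscale (NngNum (normr_ge0 a)) pm.
have nuE A : measurable A -> mu A = nu A.
  apply: lebesgue_measure_unique => _ [[u v] _ <-].
  rewrite /nu /= /mscale /= /pushforward /=.
  have [a_gt0|a_lt0|/eqP] := ltgtP 0%R a; last by rewrite eq_sym (negbTE a0).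
    have -> : phi @^-1` `]u, v] = `]((u - b) / a)%R, ((v - b) / a)%R]%classic.
      apply/seteqP; split=> x /=; rewrite !in_itv/= ltr_pdivrMr// ler_pdivlMr//;
        by rewrite ltrBlDr lerBrDr mulrC.
    rewrite !lebesgue_measure_itv/= !lte_fin ltr_pM2r ?invr_gt0// ltrD2r.
    case: ifPn => _; last by rewrite mule0.
    by rewrite -!EFinB -EFinM gtr0_norm//; congr EFin; field.
  have -> : phi @^-1` `]u, v] = `[((v - b) / a)%R, ((u - b) / a)%R[%classic.
    apply/seteqP; split=> x /=; rewrite !in_itv/= ltr_ndivlMr// ler_ndivrMr//;
      by rewrite ltrBlDr lerBrDr mulrC andbC.
  rewrite !lebesgue_measure_itv/= !lte_fin ltr_nM2r ?invr_lt0// ltrD2r.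
  case: ifPn => _; last by rewrite mule0.
  by rewrite -!EFinB -EFinM ltr0_norm//; congr EFin; field.
transitivity (\int[nu]_x f x).
  by apply: eq_measure_integral => A mA _; exact: nuE.
rewrite ge0_integral_mscale//; congr (_ * _).
by rewrite /pm ge0_integral_pushforward.
Qed.

End affine_change_of_variable.

(** * Integrability of negative powers at the origin *)

Section power_singularity.
Context {R : realType}.
Notation mu := (@lebesgue_measure R).

Lemma integral_powR_le (g e : R) : 0 < g < 1 -> 0 < e < 1 ->
  (\int[mu]_(x in `[e, 1%R]) (x `^ (- g))%:E <= ((1 - g)^-1)%:E)%E.
Proof.
move=> /andP[g0 g1] /andP[e0 e1].
have g1' : 1 - g != 0 by rewrite subr_eq0 gt_eqF.
pose G (x : R) : R := (1 - g)^-1 * x `^ (1 - g).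
have dG (x : R) : 0 < x -> is_derive x 1 G (x `^ (- g)).
  move=> x0; have dp := is_derive1_powR (1 - g) x0.
  have -> : x `^ (- g) = (1 - g)^-1 * ((1 - g) * x `^ (1 - g - 1)).
    by rewrite mulrA mulVf// mul1r; congr (_ `^ _); ring.
  rewrite -[X in is_derive _ _ _ X]/(_ *: _).
  exact: is_deriveZ.
have cG (x : R) : 0 < x -> {for x, continuous G}.
  move=> x0; apply: differentiable_continuous; apply/derivable1_diffP.
  by have [] := dG x x0.
have cp (x : R) : 0 < x -> {for x, continuous (fun y : R => y `^ (- g))}.
  move=> x0; apply: differentiable_continuous; apply/derivable1_diffP.
  by have [] := is_derive1_powR (- g) x0.
rewrite (@continuous_FTC2 _ _ G)//.
- rewrite -EFinB lee_fin /G powR1 mulr1 lerBlDr lerDl mulr_ge0 ?powR_ge0//.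
  by rewrite invr_ge0 subr_ge0 ltW.
- apply: continuous_in_subspaceT => x; rewrite inE/= in_itv/= => /andP[ex _].
  by apply: cp; rewrite (lt_le_trans e0).
- split.
  + move=> x; rewrite in_itv/= => /andP[ex _].
    by have [] := dG x (lt_trans e0 ex).
  + by apply: cvg_at_right_filter; exact: cG.
  + by apply: cvg_at_left_filter; apply: cG.
- move=> x; rewrite in_itv/= => /andP[ex _]; rewrite derive1E.
  by have [_ ->] := dG x (lt_trans e0 ex).
Qed.

Lemma measurable_fun_itv_if (a b : R) (f : R -> R) : measurable_fun setT f ->
  measurable_fun setT (fun x => if a < x < b then f x else 0).
Proof.
move=> mf; apply: measurable_fun_ifT => //.
by apply: measurable_and; exact: measurable_fun_ltr.
Qed.

Lemma integrable_powR_near0 (g : R) : 0 < g < 1 ->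
  mu.-integrable setT (EFin \o (fun x : R => if 0 < x < 1 then x `^ (- g) else 0)).
Proof.
move=> g01; apply/integrableP; split.
  by apply/measurable_EFinP; apply: measurable_fun_itv_if; exact: measurable_powR.
apply: (@le_lt_trans _ _ ((1 - g)^-1)%:E); last exact: ltry.
apply: (@le_trans _ _ (\int[mu]_(x in `]0%R, 1%R]) (x `^ (- g))%:E)%E).
  rewrite [leRHS]integral_mkcond; apply: ge0_le_integral => //.
  - apply: measurableT_comp => //; apply/measurable_EFinP.
    by apply: measurable_fun_itv_if; exact: measurable_powR.
  - apply/(measurable_restrictT _ _).1 => //.
    by apply/measurable_EFinP; apply: measurable_funTS; exact: measurable_powR.
  - move=> x _ /=; rewrite patchE mem_setE in_itv/=.
    case: ifPn => [/andP[x0 x1]|_].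
      by rewrite x0 (ltW x1) lee_fin ger0_norm// powR_ge0.
    by rewrite normr0; case: ifPn; rewrite // lee_fin powR_ge0.
(* Monotone convergence along an exhaustion; starting from [i.+2] keeps the left endpoint strictly
   below 1, as [integral_powR_le] asks. *)
have -> : `]0, 1]%classic = \bigcup_i `[i.+2%:R^-1 : R, 1]%classic.
  apply/seteqP; split=> [x /=|x [i _] /=]; rewrite !in_itv/= => /andP[x0 x1].
    have [n _ nx] := near_infty_natSinv_lt (PosNum x0).
    by exists n => //=; rewrite in_itv/= x1 andbT ltW// (nx n.+1 (leqnSn n)).
  by rewrite x1 andbT (lt_le_trans _ x0).
have mp i : measurable_fun `[i.+2%:R^-1 : R, 1] (fun x : R => (x `^ (- g))%:E).
  by apply/measurable_EFinP; apply: measurable_funTS; exact: measurable_powR.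
have nd : nondecreasing_seq (fun i => `[i.+2%:R^-1 : R, 1]%classic).
  move=> m n mn; rewrite subsetEset => x /=; rewrite !in_itv/= => /andP[mx ->].
  by rewrite andbT (le_trans _ mx)// lef_pV2 ?posrE// ler_nat !ltnS.
apply: (cvge_to_le (@ge0_nondecreasing_set_cvg_integral _ (measurableTypeR R) _
  _ (fun x : R => (x `^ (- g))%:E) mu nd _ mp _)).
- by move=> i; exact: measurable_itv.
- by move=> i x _; rewrite lee_fin powR_ge0.
- apply: nearW => i; apply: integral_powR_le => //.
  by rewrite invr_gt0 ltr0n/= invf_lt1 ?ltr0n// ltr1n.
Qed.

End power_singularity.

(** * Integrals over intervals written with cut-off functions *)

Section interval_integrals.
Context {R : realType}.
Notation mu := (@lebesgue_measure R).
Notation integrable f := (mu.-integrable setT (EFin \o f)).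
Implicit Types f : R -> R.

Lemma Rintegral_itv_if (a b : R) f :
  \int[mu]_(x in `]a, b[) f x = \int[mu]_x (if a < x < b then f x else 0).
Proof.
rewrite Rintegral_mkcond; apply: eq_Rintegral => x _.
by rewrite patchE mem_setE in_itv.
Qed.

Lemma integrable_itv_if (a b : R) f : measurable_fun setT f -> integrable f ->
  integrable (fun x => if a < x < b then f x else 0).
Proof.
move=> mf; move/integrable_norm.
apply: dominated_integrable_real; first exact: measurable_fun_itv_if.
by move=> x /=; case: ifP; rewrite ?normr0.
Qed.

Lemma integral_itv_small f (e : R) : integrable f -> 0 < e ->
  exists2 d : R, 0 < d & forall a b : R, b - a < d ->
    \int[mu]_x (if a < x < b then `|f x| else 0) <= e.
Proof.
move=> intf e0.
have [d [d0 fd]] := @integral_normr_continuous _ (measurableTypeR R) _ mu f intf e e0.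
exists d => // a b bad.
rewrite -(Rintegral_itv_if a b (fun x => `|f x|)); apply/ltW/fd => //.
rewrite [ltLHS](lebesgue_measure_itv `]a, b[) /=; by case: ifP => _; rewrite -?EFinB lte_fin.
Qed.

(** If the integral is infinite, the identity reads [0 = 0], since [fine] sends infinity to 0. *)
Lemma Rintegral_affine f (a b : R) : a != 0 -> measurable_fun setT f ->
  (forall x, 0 <= f x) -> \int[mu]_x f x = `|a| * \int[mu]_x f (a * x + b).
Proof.
move=> a0 mf f0.
have fineZ (I : \bar R) : (0 <= I)%E -> fine (`|a|%:E * I)%E = `|a| * fine I.
  case: I => [r| |]//= _; by rewrite mulr0 mulry gtr0_sg ?normr_gt0// mul1e.
rewrite /Rintegral (@ge0_integral_affine _ (EFin \o f) a b)//=.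
  by rewrite fineZ//; apply: integral_ge0 => x _; rewrite lee_fin.
exact/measurable_EFinP.
Qed.

Lemma integrable_affine f (a b : R) : a != 0 -> (forall x, 0 <= f x) ->
  integrable f -> integrable (fun x => f (a * x + b)).
Proof.
move=> a0 f0 intf; have mf := measurable_real_of_integrable intf.
have /integrableP[_] := intf.
rewrite (@ge0_integral_affine _ (abse \o (EFin \o f)) a b)//; last 2 first.
- by apply: measurableT_comp => //; exact/measurable_EFinP.
- by move=> x /=.
move=> ilt; apply/integrableP; split.
  apply/measurable_EFinP; apply: (@measurableT_comp _ _ _ _ _ _ f) => //.
  by apply: measurable_funD => //; exact: mulrl_measurable.
move: ilt => /=; set I := (X in (_ * X)%E) => ilt.
rewrite -[X in (X < _)%E]/I; move: ilt.
have I0 : (0 <= I)%E by apply: integral_ge0.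
by case: I I0 => [r| |]//; rewrite ?ltry// mulry gtr0_sg ?normr_gt0// mul1e.
Qed.

End interval_integrals.

(** * Bounds and continuity of the singular kernel *)

Section singular_kernel.
Context {R : realType}.
Notation mu := (@lebesgue_measure R).
Notation integrable f := (mu.-integrable setT (EFin \o f)).

Definition weighted_kernel (a t s : R) : R :=
  if 0 < s < t then t `^ a * (t - s) `^ (- a) else 0.

Lemma weighted_kernel_ge0 a t s : 0 <= weighted_kernel a t s.
Proof. by rewrite /weighted_kernel; case: ifP; rewrite ?mulr_ge0 ?powR_ge0. Qed.

Lemma weighted_kernel_out a (t s : R) : ~~ (0 < s < t) -> weighted_kernel a t s = 0.
Proof. by rewrite /weighted_kernel => /negbTE ->. Qed.

Lemma measurable_powR_sub (c t : R) : measurable_fun setT (fun s : R => (t - s) `^ c).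
Proof.
apply: (@measurableT_comp _ _ _ _ _ _ (fun x : R => x `^ c)).
  exact: measurable_powR.
exact: measurable_funB.
Qed.

Lemma measurable_weighted_kernel a (t : R) :
  measurable_fun setT (weighted_kernel a t).
Proof.
apply: measurable_fun_itv_if; apply: measurable_funM => //.
exact: measurable_powR_sub.
Qed.

Lemma weighted_kernel_bounded a (T eta : R) : 0 < a -> 0 < eta ->
  exists M : R, forall t s : R, t <= T -> s <= t - eta -> weighted_kernel a t s <= M.
Proof.
move=> a0 eta0; exists (T `^ a * eta `^ (- a)) => t s tT st.
rewrite /weighted_kernel; case: ifP => [/andP[s0 s_t]|_]; last first.
  by rewrite mulr_ge0 ?powR_ge0.
have t0 : 0 < t by exact: lt_trans s_t.
apply: ler_pM; rewrite ?powR_ge0//.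
  by apply: ge0_ler_powR; rewrite ?nnegrE; lra.
have ts0 : 0 < t - s by lra.
rewrite !powRN lef_pV2 ?posrE ?powR_gt0//.
by apply: ge0_ler_powR; rewrite ?nnegrE; lra.
Qed.

Lemma continuous_powR_gt0 (c x : R) : 0 < x -> {for x, continuous (fun y : R => y `^ c)}.
Proof.
move=> x0; apply: differentiable_continuous; apply/derivable1_diffP.
by have [] := is_derive1_powR c x0.
Qed.

Lemma weighted_kernel_cvg a (t0 s : R) : s != t0 ->
  weighted_kernel a t s @[t --> t0] --> weighted_kernel a t0 s.
Proof.
move=> st0; have [s0|s0] := leP s 0.
  have k0 t : weighted_kernel a t s = 0.
    by rewrite weighted_kernel_out// ltNge s0.
  by rewrite k0; under eq_fun do rewrite k0; exact: cvg_cst.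
have [ts|st|ts] := ltgtP t0 s; last by rewrite ts eqxx in st0.
  rewrite [X in _ --> X]weighted_kernel_out; last by rewrite [s < _]ltNge (ltW ts) andbF.
  apply: (@cvg_near_cst R R); near=> t; apply: weighted_kernel_out.
  by rewrite negb_and -leNgt orbC -leNgt; apply/orP; left; apply: ltW;
    near: t; exact: lt_nbhsl.
have kt0 : t `^ a * (t - s) `^ (- a) @[t --> t0] --> t0 `^ a * (t0 - s) `^ (- a).
  apply: cvgM; first by apply: continuous_powR_gt0; exact: lt_trans st.
  apply: (@continuous_cvg _ _ _ _ _ (fun t => t - s) (fun y : R => y `^ (- a))).
    by apply: continuous_powR_gt0; rewrite subr_gt0.
  by apply: (@cvgB _ R^o); [exact: cvg_id|exact: cvg_cst].
rewrite {2}/weighted_kernel s0 st; apply: cvg_trans kt0; apply: near_eq_cvg.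
near=> t; rewrite /weighted_kernel s0/=.
suff -> : s < t by [].
by near: t; exact: lt_nbhsr.
Unshelve. all: end_near. Qed.

(** * The singular kernel against a weight with [s^a L(s)] locally in L^p *)

Section weights.
Context (a p q : R) (L : R -> R).
Hypotheses (a_gt0 : 0 < a) (p_gt0 : 0 < p) (q_gt0 : 0 < q).
Hypotheses (pq : p^-1 + q^-1 = 1) (aq : a * q < 1).
Hypotheses (L_meas : measurable_fun setT L) (L_ge0 : forall s, 0 <= L s).
Hypothesis L_le0 : forall s, s <= 0 -> L s = 0.

Let H (s : R) : R := (s `^ a * L s) `^ p.

Hypothesis H_int : forall T : R, integrable (fun s : R => if s <= T then H s else 0).

Let H_meas : measurable_fun setT H.
Proof.
apply: (@measurableT_comp _ _ _ _ _ _ (fun x : R => x `^ p)).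
  exact: measurable_powR.
by apply: measurable_funM => //; exact: measurable_powR.
Qed.

(** Young's inequality with its coefficients [1/q] and [1/p], both at most 1, dropped. *)
Lemma young_powR (r y : R) : 0 < r -> 0 <= y ->
  r `^ (- a) * y <= r `^ (- (a * q)) + y `^ p.
Proof.
move=> r0 y0; have pq' : q^-1 + p^-1 = 1 by rewrite addrC.
have := conjugate_powR (powR_ge0 r (- a)) y0 q_gt0 p_gt0 pq'.
rewrite -powRrM mulNr => /le_trans; apply.
have := invr_gt0 p; rewrite p_gt0 => ip0; have := invr_gt0 q; rewrite q_gt0 => iq0.
by apply: lerD; rewrite ler_piMr ?powR_ge0//; lra.
Qed.

(** Write [L s] as [s^(-a)] times [s^a L s] and apply [young_powR] with [r = s]. The power [s^(-aq)]
    is integrable near 0 because [a * q < 1], and it is at most 1 from 1 on, where the indicator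
    dominates it. *)
Lemma L_integrable (T : R) : integrable (fun s : R => if s <= T then L s else 0).
Proof.
have g01 : 0 < a * q < 1 by rewrite mulr_gt0.
apply: (@dominated_integrable_real _ _ (fun s : R =>
  (if 0 < s < 1 then s `^ (- (a * q)) else 0) + (\1_`[0, T] s +
  (if s <= T then H s else 0)))).
- by apply: measurable_fun_ifT => //; exact: measurable_fun_ler.
- move=> s; have H0 : 0 <= H s by exact: powR_ge0.
  have i0 : 0 <= \1_`[0, T] s :> R by rewrite indicE.
  have g0 : 0 <= (if 0 < s < 1 then s `^ (- (a * q)) else 0).
    by case: ifP; rewrite ?powR_ge0.
  have [sT|] := leP s T; last by rewrite normr0 !addr_ge0.
  rewrite ger0_norm//.
  have [s0|s0] := leP s 0; first by rewrite L_le0// !addr_ge0.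
  have i1 : \1_`[0, T] s = 1 :> R by rewrite indicE mem_set//= in_itv/= (ltW s0).
  have -> : L s = s `^ (- a) * (s `^ a * L s).
    by rewrite mulrA -powRD ?(gt_eqF s0) ?implybT// addNr powRr0 mul1r.
  apply: (le_trans (young_powR s0 _)); first by rewrite mulr_ge0 ?powR_ge0.
  rewrite addrA lerD2r i1; have [s1|s1] := ltP s 1.
    by rewrite lerDl.
  rewrite add0r powRN invf_le1 ?powR_gt0// -(powRr0 s) ler_powR//.
  by move/andP: g01 => [/ltW].
- apply: integrableD_real; first exact: integrable_powR_near0.
  by apply: integrableD_real => //; exact: integrable_indic_itv.
Qed.

(** For [s < t/2] the ratio [t/(t-s)] is at most 2. For [s >= t/2] one has [t^a <= 2^a s^a]; the
    factor [s^a] joins [L s], and [young_powR] with [r = t - s] separates the singularity from the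
    weight. *)
Lemma weighted_kernel_le (t s : R) : 0 < s < t ->
  weighted_kernel a t s * L s <= 2 `^ a *
    ((if s < t - s then L s else 0) +
     ((t - s) `^ (- (a * q)) + H s)).
Proof.
move=> st; rewrite /weighted_kernel st; move/andP: st => [s0 st].
have ts0 : 0 < t - s by lra.
have a0 : 0 <= a by exact: ltW.
have [s2|s2] := ltP s (t - s).
  rewrite mulrDr -[leLHS]addr0 lerD ?mulr_ge0 ?addr_ge0 ?powR_ge0//.
  rewrite ler_wpM2r// powRN ler_pdivrMr ?powR_gt0// -powRM; try lra.
  by apply: ge0_ler_powR; rewrite ?nnegrE; lra.
rewrite add0r.
have ta : t `^ a <= 2 `^ a * s `^ a.
  by rewrite -powRM; try lra; apply: ge0_ler_powR; rewrite ?nnegrE; lra.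
apply: (@le_trans _ _ (2 `^ a * ((t - s) `^ (- a) * (s `^ a * L s)))).
  have -> : 2 `^ a * ((t - s) `^ (- a) * (s `^ a * L s)) =
    (2 `^ a * s `^ a) * (t - s) `^ (- a) * L s by ring.
  by rewrite !ler_wpM2r ?powR_ge0.
rewrite ler_wpM2l ?powR_ge0//; apply: young_powR => //.
by rewrite mulr_ge0 ?powR_ge0.
Qed.

Let tail (eta t s : R) : R := if t - eta < s then weighted_kernel a t s * L s else 0.

Let tail_meas eta t : measurable_fun setT (tail eta t).
Proof.
apply: measurable_fun_ifT => //; first exact: measurable_fun_ltr.
by apply: measurable_funM => //; exact: measurable_weighted_kernel.
Qed.

(** On the tail, each of the three terms of [weighted_kernel_le] lives on an interval of length
    [eta]: the first on [0 < s < eta], since [s < t - s < eta]; the second on [0 < t - s < eta]; the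
    third on [t - eta < s < t]. Absolute continuity of three integrals that do not involve [t] makes
    the estimate uniform. *)
Lemma weighted_kernel_tail (T e : R) : 0 < e -> exists2 eta : R, 0 < eta &
  forall t : R, t <= T -> integrable (tail eta t) /\ \int[mu]_s tail eta t s <= e.
Proof.
move=> e0; pose c : R := 2 `^ a; have c0 : 0 < c by rewrite powR_gt0.
have g01 : 0 < a * q < 1 by rewrite mulr_gt0.
pose e' := e / (c * 3).
have e'0 : 0 < e' by rewrite divr_gt0// mulr_gt0.
pose phi (r : R) : R := if 0 < r < 1 then r `^ (- (a * q)) else 0.
pose L1 (s : R) : R := if s <= 1 then L s else 0.
pose HT (s : R) : R := if s <= T then H s else 0.
have phi_int : integrable phi by exact: integrable_powR_near0.
have L1_int : integrable L1 by exact: L_integrable.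
have HT_int : integrable HT by exact: H_int.
have [d1 d1_gt0 L1_small] := integral_itv_small L1_int e'0.
have [d2 d2_gt0 phi_small] := integral_itv_small phi_int e'0.
have [d3 d3_gt0 HT_small] := integral_itv_small HT_int e'0.
(* Halving makes [eta] strictly smaller than each [d]. With [eta < 1], [phi] and [L1] agree with the
   power and with [L] where they are used. *)
pose eta := Num.min (Num.min d1 d2) (Num.min d3 1) / 2.
have m0 : 0 < Num.min (Num.min d1 d2) (Num.min d3 1).
  by rewrite !lt_min d1_gt0 d2_gt0 d3_gt0 ltr01.
have eta0 : 0 < eta by rewrite divr_gt0.
have /andP[/andP[ed1 ed2] /andP[ed3 e1]] :
    ((eta < d1) && (eta < d2)) && ((eta < d3) && (eta < 1)).
  by rewrite -!lt_min /eta; lra.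
exists eta => // t tT.
pose B1 (s : R) := if 0 < s < eta then `|L1 s| else 0.
pose B2 (r : R) := if 0 < r < eta then `|phi r| else 0.
pose B3 (s : R) := if t - eta < s < t then `|HT s| else 0.
have absm f : integrable f -> measurable_fun setT (fun s => `|f s|).
  by move=> /measurable_real_of_integrable mf; exact: measurableT_comp.
have B1_int : integrable B1 by apply: integrable_itv_if;
  [exact: absm|exact: integrable_norm].
have B2_int : integrable B2 by apply: integrable_itv_if;
  [exact: absm|exact: integrable_norm].
have B3_int : integrable B3 by apply: integrable_itv_if;
  [exact: absm|exact: integrable_norm].
have B2_ge0 r : 0 <= B2 r by rewrite /B2; case: ifP.
have B2t_int : integrable (fun s : R => B2 (-1 * s + t)).
  by apply: integrable_affine => //; rewrite oppr_eq0 oner_neq0.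
have B_int : integrable (fun s : R => c * (B1 s + (B2 (-1 * s + t) + B3 s))).
  by apply: integrableZl_real; do 2 apply: integrableD_real => //.
have tailB s : `|tail eta t s| <= c * (B1 s + (B2 (-1 * s + t) + B3 s)).
  have B0 : 0 <= c * (B1 s + (B2 (-1 * s + t) + B3 s)).
    by rewrite mulr_ge0 ?(ltW c0)// !addr_ge0// ?/B1 ?/B3; case: ifP.
  rewrite /tail; case: ifPn => [ts|_]; last by rewrite normr0.
  rewrite ger0_norm; last by rewrite mulr_ge0// weighted_kernel_ge0.
  have [st|st] := boolP (0 < s < t); last by rewrite weighted_kernel_out// mul0r.
  apply: (le_trans (weighted_kernel_le st)).
  move/andP: st => [s0 st]; rewrite ler_wpM2l ?(ltW c0)//.
  have sT : s <= T by exact: le_trans (ltW st) tT.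
  have -> : B2 (-1 * s + t) = (t - s) `^ (- (a * q)).
    have -> : -1 * s + t = t - s by ring.
    have t1 : t - s < 1 by lra.
    have t2 : t - s < eta by lra.
    have t3 : 0 < t - s by lra.
    by rewrite /B2 t3 t2 /phi t3 t1 ger0_norm ?powR_ge0.
  have -> : B3 s = H s by rewrite /B3 ts st /HT sT ger0_norm ?powR_ge0.
  rewrite lerD2r /B1; case: ifPn => [s2|_]; last by case: ifP.
  have -> : s < eta by lra.
  by rewrite s0 /L1 (_ : s <= 1) ?ger0_norm//; lra.
split; first exact: dominated_integrable_real B_int.
apply: (le_trans (ler_norm _)).
apply: (le_trans (norm_Rintegral_dominated _ tailB B_int)) => //.
rewrite RintegralZl//; last by do 2 apply: integrableD_real => //.
rewrite !RintegralD//; last exact: integrableD_real.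
have <- : \int[mu]_s B2 s = \int[mu]_s B2 (-1 * s + t).
  rewrite (@Rintegral_affine _ _ (-1) t) ?oppr_eq0 ?oner_neq0 ?normrN ?normr1 ?mul1r//.
  exact: measurable_real_of_integrable B2_int.
have b1 : \int[mu]_s B1 s <= e' by apply: L1_small; rewrite subr0.
have b2 : \int[mu]_s B2 s <= e' by apply: phi_small; rewrite subr0.
have b3 : \int[mu]_s B3 s <= e' by apply: HT_small; rewrite opprB addrC subrK.
rewrite mulrC -ler_pdivlMr//.
have -> : e / c = e' + (e' + e') by rewrite /e'; field; rewrite gt_eqF.
by rewrite !lerD.
Qed.

(** The tail near the diagonal is integrable by [weighted_kernel_tail]; elsewhere the kernel is
    bounded and [L] is integrable up to [t]. *)
Lemma weighted_kernel_integrable (t : R) :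
  integrable (fun s : R => weighted_kernel a t s * L s).
Proof.
have [eta eta0 tailP] := weighted_kernel_tail t (@ltr01 R).
have [tail_int _] := tailP t (lexx t).
have [M kM] := weighted_kernel_bounded t a_gt0 eta0.
have M0 : 0 <= M.
  by apply: le_trans (weighted_kernel_ge0 a t (t - eta)) (kM _ _ _ _).
apply: (@dominated_integrable_real _ _ (fun s : R =>
  M * (if s <= t then L s else 0) + tail eta t s)).
- by apply: measurable_funM => //; exact: measurable_weighted_kernel.
- move=> s; rewrite ger0_norm; last by rewrite mulr_ge0// weighted_kernel_ge0.
  have [ts|st] := leP t s.
    rewrite weighted_kernel_out ?mul0r; last by rewrite [s < t]ltNge ts andbF.
    rewrite addr_ge0// ?mulr_ge0//; first by case: ifP.
    by rewrite /tail; case: ifP; rewrite ?mulr_ge0 ?weighted_kernel_ge0.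
  have -> : s <= t by exact: ltW.
  rewrite /tail; case: ltP => ts.
    by rewrite lerDr mulr_ge0.
  by rewrite addr0 ler_wpM2r// kM.
- by apply: integrableD_real => //; apply: integrableZl_real; exact: L_integrable.
Qed.

End weights.

End singular_kernel.

(** * Riemann-Liouville integrals of solutions *)

Section euler_integrals.
Context {R : realType}.
Notation mu := (@lebesgue_measure R).
Notation integrable f := (mu.-integrable setT (EFin \o f)).

Lemma powRN_ge1 (c x : R) : 0 <= c -> 0 < x <= 1 -> 1 <= x `^ (- c).
Proof.
move=> c0 /andP[x0 x1]; rewrite -(powRr0 x) ger_powR ?x0 ?x1//.
by rewrite oppr_le0.
Qed.

Lemma Rintegral_itv01_cst (c : R) : \int[mu]_x (if 0 < x < 1 then c else 0) = c.
Proof.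
rewrite -(Rintegral_itv_if 0 1 (cst c)) Rintegral_cst//.
rewrite [X in fine X](lebesgue_measure_itv `]0, 1[) /= lte_fin ltr01.
by rewrite -EFinB subr0 /= mulr1.
Qed.

Lemma integrable_itv01_cst (c : R) :
  integrable (fun x : R => if 0 < x < 1 then c else 0).
Proof.
apply: (@dominated_integrable_real _ _ (fun s => `|c| * \1_`[0, 1] s)).
- exact: measurable_fun_itv_if.
- move=> s; case: ifPn => [/andP[s0 s1]|_].
    by rewrite indicE mem_set ?mulr1//= in_itv/= !ltW.
  by rewrite normr0 mulr_ge0// indicE.
- by apply: integrableZl_real; exact: integrable_indic_itv.
Qed.

(** The integrand is at least [expR (-1)] on (0, 1). Comparing real integrals also takes
    integrability, obtained from [t^(a-1)] below 1 and from the exponential density above. *)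
Lemma Gamma_gt0 (a : R) : 0 < a < 1 -> 0 < Gamma a.
Proof.
move=> /andP[a0 a1]; rewrite /Gamma Rintegral_mkcond.
set g := _ \_ _.
have gE (t : R) : g t = if 0 < t then t `^ (- (1 - a)) * expR (- t) else 0.
  by rewrite /g patchE mem_setE in_itv/= andbT opprB.
have mg : measurable_fun setT g.
  apply/(measurable_restrictT _ _).1 => //; apply: measurable_funTS.
  apply: measurable_funM; first exact: measurable_powR.
  by apply: measurableT_comp => //; exact: measurable_expR.
have exp_ge0 (t : R) : 0 <= exponential_pdf 1 t by exact: exponential_pdf_ge0.
have e10 : 0 < expR (-1) :> R by exact: expR_gt0.
rewrite (lt_le_trans e10)// -[leLHS]Rintegral_itv01_cst.
apply: le_Rintegral => //; first exact: integrable_itv01_cst.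
  apply: (@dominated_integrable_real _ _ (fun t : R =>
    (if 0 < t < 1 then t `^ (- (1 - a)) else 0) + exponential_pdf 1 t)) => //.
  - move=> t; rewrite gE; case: ifPn => [t0|t0]; last first.
      rewrite normr0 addr_ge0//; by case: ifP; rewrite ?powR_ge0.
    rewrite ger0_norm ?mulr_ge0 ?powR_ge0 ?expR_ge0//.
    have [t1|t1] := ltP t 1.
      rewrite /= -[leLHS]addr0 lerD//.
      by rewrite ler_piMr ?powR_ge0// expR_le1 oppr_le0 ltW.
    rewrite add0r (@exponential_pdfE _ 1 t (ltW t0)) mul1r mulN1r.
    rewrite ler_piMl ?expR_ge0// powRN invf_le1 ?powR_gt0//.
    by rewrite -[leLHS](powRr0 t) ler_powR// subr_ge0 ltW.
  - apply: integrableD_real; last exact: integrable_exponential_pdf.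
    by apply: integrable_powR_near0; apply/andP; split; lra.
move=> t _; rewrite gE; case: ifPn => [/andP[t0 t1]|_].
  rewrite t0 -[leLHS]mul1r ler_pM ?expR_ge0//.
    by apply: powRN_ge1; rewrite ?t0 ?(ltW t1)// subr_ge0 ltW.
  by rewrite ler_expR lerN2 ltW.
by case: ifP => // _; rewrite mulr_ge0 ?powR_ge0 ?expR_ge0.
Qed.

Definition beta_integrand (a b s : R) : R :=
  if 0 < s < 1 then s `^ (- a) * (1 - s) `^ (- b) else 0.

(** In the classical normalisation this is Euler's beta function at [(1 - a, 1 - b)]. *)
Definition beta_integral (a b : R) : R := \int[mu]_s beta_integrand a b s.

Lemma beta_integrand_ge0 (a b s : R) : 0 <= beta_integrand a b s.
Proof. by rewrite /beta_integrand; case: ifP; rewrite ?mulr_ge0 ?powR_ge0. Qed.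

Lemma measurable_beta_integrand (a b : R) : measurable_fun setT (beta_integrand a b).
Proof.
apply: measurable_fun_itv_if; apply: measurable_funM.
  exact: measurable_powR.
exact: measurable_powR_sub.
Qed.

Lemma powRN_le_half (c x : R) : 0 <= c -> 2^-1 <= x -> x `^ (- c) <= 2 `^ c.
Proof.
move=> c0 x2; have x0 : 0 < x by lra.
rewrite powRN -[leLHS]mul1r ler_pdivrMr ?powR_gt0// -powRM ?(ltW x0)//.
by rewrite -[leLHS](powRr0 (2 * x)) ler_powR//; lra.
Qed.

(** On either side of 1/2 only one factor is singular; the other is bounded by [powRN_le_half]. *)
Lemma integrable_beta_integrand (a b : R) : 0 < a < 1 -> 0 < b < 1 ->
  integrable (beta_integrand a b).
Proof.
move=> a01 b01; move/andP: (a01) => [a0 a1]; move/andP: (b01) => [b0 b1].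
pose phi (c r : R) : R := if 0 < r < 1 then r `^ (- c) else 0.
have phi_ge0 c r : 0 <= phi c r by rewrite /phi; case: ifP; rewrite ?powR_ge0.
apply: (@dominated_integrable_real _ _ (fun s : R =>
  2 `^ b * phi a s + 2 `^ a * phi b (-1 * s + 1))).
- exact: measurable_beta_integrand.
- move=> s; rewrite ger0_norm ?beta_integrand_ge0//.
  rewrite /beta_integrand; case: ifPn => [|_]; last first.
    by rewrite addr_ge0// mulr_ge0 ?powR_ge0.
  move=> /andP[s0 s1]; have [s2|s2] := leP s 2^-1.
    rewrite -[leLHS]addr0 lerD ?mulr_ge0 ?powR_ge0//.
    rewrite /phi s0 s1 mulrC ler_wpM2r ?powR_ge0// powRN_le_half; lra.
  rewrite -[leLHS]add0r lerD ?mulr_ge0 ?powR_ge0//.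
  have -> : -1 * s + 1 = 1 - s by ring.
  have s3 : 0 < 1 - s < 1 by apply/andP; split; lra.
  rewrite /phi s3 ler_wpM2r ?powR_ge0// powRN_le_half; lra.
- apply: integrableD_real; apply: integrableZl_real.
    exact: integrable_powR_near0.
  apply: (@integrable_affine _ (phi b)) => //.
  exact: integrable_powR_near0.
Qed.

Lemma beta_integral_gt0 (a b : R) : 0 < a < 1 -> 0 < b < 1 -> 0 < beta_integral a b.
Proof.
move=> a01 b01; rewrite (lt_le_trans ltr01)// -[leLHS]Rintegral_itv01_cst.
apply: le_Rintegral => //.
- exact: integrable_itv01_cst.
- exact: integrable_beta_integrand.
- move=> s _; rewrite /beta_integrand; case: ifPn => [/andP[s0 s1]|]; last by rewrite lexx.
  move/andP: a01 => [a0 _]; move/andP: b01 => [b0 _].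
  by apply: mulr_ege1; apply: powRN_ge1; rewrite ?(ltW a0) ?(ltW b0)//; apply/andP; split; lra.
Qed.

(* Under the substitution [s = r + (t - r) * x], the powers of [t - r] cancel because
   [a + b = 1]. *)
Lemma beta_integral_shift (a b r t : R) : 0 < a < 1 -> 0 < b < 1 -> a + b = 1 ->
  r < t ->
  \int[mu]_s (if r < s < t then (s - r) `^ (- a) * (t - s) `^ (- b) else 0) =
  beta_integral a b.
Proof.
move=> a01 b01 ab rt; have tr : 0 < t - r by rewrite subr_gt0.
rewrite (@Rintegral_affine _ _ (t - r) r) ?gt_eqF//; last 2 first.
- apply: measurable_fun_itv_if; apply: measurable_funM; last exact: measurable_powR_sub.
  apply: (@measurableT_comp _ _ _ _ _ _ (fun x : R => x `^ (- a))).
    exact: measurable_powR.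
  exact: measurable_funB.
- by move=> s; case: ifP; rewrite ?mulr_ge0 ?powR_ge0.
transitivity (`|t - r| * \int[mu]_x ((t - r)^-1 * beta_integrand a b x)).
  congr (_ * _); apply: eq_Rintegral => x _; rewrite /beta_integrand.
  have -> : (r < (t - r) * x + r < t) = (0 < x < 1).
    by rewrite -ltrBlDr subrr pmulr_rgt0// -ltrBrDr gtr_pMr.
  case: ifPn => [/andP[x0 x1]|_]; last by rewrite mulr0.
  have -> : (t - r) * x + r - r = (t - r) * x by ring.
  have -> : t - ((t - r) * x + r) = (t - r) * (1 - x) by ring.
  rewrite !powRM; try lra.
  rewrite mulrACA -powRD ?(gt_eqF tr) ?implybT// -opprD ab powR_inv1//.
  exact: ltW.
rewrite RintegralZl//; last exact: integrable_beta_integrand.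
by rewrite gtr0_norm// mulVKf// gt_eqF.
Qed.

End euler_integrals.

(** * Composition of Abel kernels *)

Section abel_composition.
Context {R : realType}.
Notation mu := (@lebesgue_measure R).
Notation integrable f := (mu.-integrable setT (EFin \o f)).

(** Up to the factor [1 / Gamma (1 - c)], the kernel of the Riemann-Liouville integral of order
    [1 - c]. *)
Definition abel_kernel (c t s : R) : R := if 0 < s < t then (t - s) `^ (- c) else 0.

Lemma abel_kernel_ge0 (c t s : R) : 0 <= abel_kernel c t s.
Proof. by rewrite /abel_kernel; case: ifP; rewrite ?powR_ge0. Qed.

Lemma measurable_abel_kernel2 (c : R) : measurable_fun [set: measurableTypeR R * measurableTypeR R]
  (fun z => abel_kernel c z.1 z.2).
Proof.
apply: measurable_fun_ifT => //.
- apply: measurable_and; first exact: measurable_fun_ltr.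
  by apply: measurable_fun_ltr.
- apply: (@measurableT_comp _ _ _ _ _ _ (fun x : R => x `^ (- c))).
    exact: measurable_powR.
  exact: measurable_funB.
Qed.

Lemma measurable_abel_kernel1 (c s : R) :
  measurable_fun setT (fun t => abel_kernel c t s).
Proof.
apply: measurable_fun_ifT => //.
- by apply: measurable_and => //; exact: measurable_fun_ltr.
- apply: (@measurableT_comp _ _ _ _ _ _ (fun x : R => x `^ (- c))).
    exact: measurable_powR.
  exact: measurable_funB.
Qed.

Lemma abel_kernel_mul_out (a b t r s : R) : ~~ (0 < r < t) ->
  abel_kernel b t s * abel_kernel a s r = 0.
Proof.
move=> rt; rewrite /abel_kernel.
case: ifPn => [/andP[s0 st]|_]; last by rewrite mul0r.
case: ifPn => [/andP[r0 rs]|_]; last by rewrite mulr0.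
by rewrite r0 (lt_trans rs st) in rt.
Qed.

Lemma integral_abel_kernel_mul (a b t r : R) : 0 < a < 1 -> 0 < b < 1 -> a + b = 1 ->
  \int[mu]_s (abel_kernel b t s * abel_kernel a s r) =
  if 0 < r < t then beta_integral a b else 0.
Proof.
move=> a01 b01 ab; case: ifPn => [/andP[r0 rt]|rt].
  rewrite -(beta_integral_shift a01 b01 ab rt); apply: eq_Rintegral => s _.
  rewrite /abel_kernel r0 /=; have [rs|sr] := ltP r s; last by rewrite mulr0.
  rewrite (lt_trans r0 rs)/=.
  by case: ifP => _; rewrite ?mul0r// mulrC.
rewrite (_ : (fun s => _) = cst 0) ?Rintegral_cst ?mul0r//.
by apply/funext => s; exact: abel_kernel_mul_out.
Qed.

(* An infinite integral would have real part [0]. *)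
Lemma integrable_of_Rintegral_gt0 (f : R -> R) : measurable_fun setT f ->
  (forall x, 0 <= f x) -> 0 < \int[mu]_x f x -> integrable f.
Proof.
move=> mf f0 intf; apply/integrableP; split; first exact/measurable_EFinP.
under eq_integral do rewrite /= ger0_norm//.
move: intf; rewrite /Rintegral; set I := integral _ _ _.
have : (0 <= I)%E by apply: integral_ge0 => s _; rewrite lee_fin.
by case: I => [r'| |]//=; rewrite ?ltry ?ltxx.
Qed.

(** The case [r = 0] of [beta_integral_shift]. It is separate from [integral_abel_kernel_mul]
    because [abel_kernel a s 0] is 0 by definition. *)
Lemma integrable_abel_kernel_powR (a b t : R) : 0 < a < 1 -> 0 < b < 1 -> a + b = 1 ->
  0 < t -> integrable (fun s => abel_kernel b t s * s `^ (- a)) /\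
  \int[mu]_s (abel_kernel b t s * s `^ (- a)) = beta_integral a b.
Proof.
move=> a01 b01 ab t0.
have intE : \int[mu]_s (abel_kernel b t s * s `^ (- a)) = beta_integral a b.
  rewrite -(beta_integral_shift a01 b01 ab t0); apply: eq_Rintegral => s _.
  by rewrite /abel_kernel subr0; case: ifP; rewrite ?mul0r// mulrC.
split=> //; apply: integrable_of_Rintegral_gt0.
- apply: measurable_funM; last exact: measurable_powR.
  by apply: measurable_fun_itv_if; exact: measurable_powR_sub.
- by move=> s; rewrite mulr_ge0 ?abel_kernel_ge0 ?powR_ge0.
- by rewrite intE beta_integral_gt0.
Qed.

Lemma integrable_abel_kernel_mul (a b t r : R) : 0 < a < 1 -> 0 < b < 1 -> a + b = 1 ->
  integrable (fun s => abel_kernel b t s * abel_kernel a s r).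
Proof.
move=> a01 b01 ab.
have [rt|rt] := boolP (0 < r < t); last first.
  rewrite (_ : (fun s => _) = cst 0); first exact: integrable0.
  by apply/funext => s; exact: abel_kernel_mul_out.
apply: integrable_of_Rintegral_gt0.
- apply: measurable_funM; last exact: measurable_abel_kernel1.
  by apply: measurable_fun_itv_if; exact: measurable_powR_sub.
- by move=> s; rewrite mulr_ge0 ?abel_kernel_ge0.
- by rewrite integral_abel_kernel_mul// rt beta_integral_gt0.
Qed.

(** Fubini: integrating in [s] first, the two kernels produce the constant [beta_integral a b] on
    [0 < r < t]. The same computation with [|G|] gives absolute integrability on the product. *)
Lemma abel_composition (a b t : R) (G : R -> R) :
  0 < a < 1 -> 0 < b < 1 -> a + b = 1 -> measurable_fun setT G ->
  (forall s, integrable (fun r => abel_kernel a s r * G r)) ->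
  integrable (fun r => if 0 < r < t then G r else 0) ->
  integrable (fun s => abel_kernel b t s * \int[mu]_r (abel_kernel a s r * G r)) /\
  \int[mu]_s (abel_kernel b t s * \int[mu]_r (abel_kernel a s r * G r)) =
  beta_integral a b * \int[mu]_r (if 0 < r < t then G r else 0).
Proof.
move=> a01 b01 ab mG Gs Gt.
pose H (z : measurableTypeR R * measurableTypeR R) : R :=
  abel_kernel b t z.1 * (abel_kernel a z.1 z.2 * G z.2).
have mH : measurable_fun setT H.
  apply: measurable_funM.
    apply: (@measurableT_comp _ _ _ _ _ _ (abel_kernel b t)) => //.
    by apply: measurable_fun_itv_if; exact: measurable_powR_sub.
  apply: measurable_funM; first exact: measurable_abel_kernel2.
  exact: (@measurableT_comp _ _ _ _ _ _ G).
have Hint1 (s : R) : (\int[mu]_r (H (s, r))%:E)%E =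
    (abel_kernel b t s * \int[mu]_r (abel_kernel a s r * G r))%:E.
  rewrite /H /=. under eq_integral do rewrite EFinM.
  rewrite integralZl//; last exact: Gs.
  by rewrite EFinM /Rintegral fineK//; apply: integrable_fin_num; rewrite ?Gs.
have kern_int r := integrable_abel_kernel_mul t r a01 b01 ab.
(* Stated for any [f], to serve with [|G|] for integrability and with [G] for the value. *)
have Hint2 (r : R) (f : R -> R) :
    (\int[mu]_s (abel_kernel b t s * (abel_kernel a s r * f r))%:E)%E =
    (beta_integral a b * (if 0 < r < t then f r else 0))%:E.
  transitivity ((f r)%:E * \int[mu]_s (abel_kernel b t s * abel_kernel a s r)%:E)%E.
    rewrite -integralZl//; last exact: kern_int.
    by apply: eq_integral => s _; rewrite -EFinM; congr EFin; ring.
  rewrite -[X in (_ * X)%E]fineK; last by apply: integrable_fin_num; rewrite ?kern_int.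
  rewrite -[X in (_ * X%:E)%E]/(\int[mu]_s _) integral_abel_kernel_mul//.
  by rewrite -EFinM; case: ifP => _; rewrite ?mulr0// mulrC.
have HnormE (r : R) : (\int[mu]_s `|(H (s, r))%:E|)%E =
    (beta_integral a b * (if 0 < r < t then `|G r| else 0))%:E.
  rewrite -(Hint2 r (fun r => `|G r|)); apply: eq_integral => s _.
  rewrite /H /= !normrM (ger0_norm (abel_kernel_ge0 _ _ _)).
  by rewrite (ger0_norm (abel_kernel_ge0 _ _ _)).
have GtN : integrable (fun r => beta_integral a b * (if 0 < r < t then `|G r| else 0)).
  apply: integrableZl_real; have := integrable_norm Gt.
  apply: eq_integrable => // r _ /=; congr EFin.
  by case: ifP; rewrite ?normr0.
have Hfin : (mu \x mu)%E.-integrable setT (EFin \o H).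
  apply/integrable21ltyP; first exact/measurable_EFinP.
  under eq_integral do rewrite HnormE.
  exact: integrable_lty.
have HG (r : R) : (\int[mu]_s (H (s, r))%:E)%E =
    (beta_integral a b * (if 0 < r < t then G r else 0))%:E.
  by rewrite -(Hint2 r G).
split.
  have := integrable_fubini_F Hfin; apply: eq_integrable => // s _.
  exact: Hint1.
have := Fubini Hfin.
under eq_integral do rewrite Hint1.
under [in X in _ = X -> _]eq_integral do rewrite HG.
move=> FubE; rewrite [LHS]/Rintegral FubE -[LHS]/(\int[mu]_r _).
by rewrite RintegralZl.
Qed.

End abel_composition.

(** * Absolute continuity and derivatives of primitives *)

Section primitives.
Context {R : realType}.
Notation mu := (@lebesgue_measure R).
Notation integrable f := (mu.-integrable setT (EFin \o f)).

Definition primitive (h : R -> R) (t : R) : R := \int[mu]_x (if 0 < x < t then h x else 0).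

Lemma primitive_diff_le (h : R -> R) (T u v : R) :
  integrable (fun x => if 0 < x < T then h x else 0) -> 0 <= u -> u <= v -> v <= T ->
  `|primitive h v - primitive h u| <=
  \int[mu]_(x in `]u, v[) `|if 0 < x < T then h x else 0|.
Proof.
move=> hT u0 uv vT.
set phi := fun x : R => if 0 < x < T then h x else 0.
have cutE w : w <= T -> (fun x => if 0 < x < w then h x else 0) =
    (fun x => if 0 < x < w then phi x else 0).
  move=> wT; apply/funext => x; case: ifPn => // /andP[x0 xw].
  by rewrite /phi x0 (lt_le_trans xw wT).
have mphi : measurable_fun setT phi := measurable_real_of_integrable hT.
have cut_int w : w <= T -> integrable (fun x => if 0 < x < w then h x else 0).
  by move=> wT; rewrite cutE//; exact: integrable_itv_if.
have phiN : integrable (fun x => `|phi x|) by exact: integrable_norm.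
rewrite /primitive -RintegralB//; [|exact: cut_int|apply: cut_int; exact: le_trans vT].
(* The difference of the two cut-off functions lives on [[u, v[]; adding the endpoint [u] does not
   change the integral. *)
rewrite Rintegral_itv_obnd_cbnd; last first.
  by apply: (integrableS _ _ _ phiN).
rewrite [leRHS]Rintegral_mkcond; apply: norm_Rintegral_dominated.
- apply: measurable_funB; apply: measurable_real_of_integrable; apply: cut_int => //.
  exact: le_trans vT.
- move=> x; rewrite patchE mem_setE in_itv/= /phi.
  have [x0|x0] := boolP (0 < x); rewrite /= ?subrr ?normr0; last by case: ifP.
  have [xu|ux] := ltP x u.
    by rewrite (lt_le_trans xu uv) subrr normr0; case: ifP.
  rewrite subr0; case: ifPn => [xv|_]; last by rewrite normr0.
  by rewrite (lt_le_trans xv vT).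
- have : mu.-integrable `[u, v[ (EFin \o (fun x => `|phi x|)).
    by apply: (integrableS _ _ _ phiN).
  by move/(integrable_mkcond _ _).1; rewrite restrict_EFin; apply.
Qed.

(** The sum of increments is at most the integral of [|h|] over the disjoint union of the intervals,
    whose measure is less than [d]. *)
Lemma primitive_absolutely_continuous (h : R -> R) (C T : R) :
  integrable (fun x => if 0 < x < T then h x else 0) ->
  absolutely_continuous 0 T (fun t => C + primitive h t).
Proof.
move=> hT e e0.
have [d [d0 hd]] := @integral_normr_continuous _ (measurableTypeR R) _ mu _ hT e e0.
exists d => // n u v uv tF sd.
set phi := fun x : R => if 0 < x < T then h x else 0 in hT hd *.
have phiN : integrable (fun x => `|phi x|) by exact: integrable_norm.
pose F (i : 'I_n) : set (measurableTypeR R) := `]u i, v i[%classic.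
have mF i : measurable (F i) by exact: measurable_itv.
have mA : measurable (\big[setU/set0]_(i < n) F i) by exact: bigsetU_measurable.
apply: (@le_lt_trans _ _ (\int[mu]_(x in \big[setU/set0]_(i < n) F i) `|phi x|)).
  rewrite [leRHS]/Rintegral ge0_integral_bigsetU//; last 3 first.
  - exact: index_enum_uniq.
  - by apply: sub_trivIset tF.
  - apply: measurable_funTS; apply/measurable_EFinP.
    exact: measurable_real_of_integrable phiN.
  rewrite (eq_bigr (fun i => (\int[mu]_(x in F i) `|phi x|)%:E)); last first.
    move=> i _; rewrite /Rintegral fineK//; apply: integrable_fin_num => //.
    exact: integrableS phiN.
  rewrite sumEFin /=; apply: ler_sum => i _.
  have [ui [uvi vi]] := uv i.
  rewrite opprD addrACA subrr add0r.
  exact: primitive_diff_le.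
apply: hd => //.
rewrite [ltLHS]measure_bigsetU_ord//.
rewrite (eq_bigr (fun i => (v i - u i)%:E)) ?sumEFin ?lte_fin// => i _.
have [_ [uvi _]] := uv i.
rewrite [LHS](lebesgue_measure_itv `]u i, v i[)/= lte_fin.
by case: ltgtP uvi => // -> _; rewrite subrr.
Qed.

Lemma primitive_derivable (h : R -> R) (C t u : R) :
  integrable (fun x => if 0 < x < u then h x else 0) -> 0 < t -> t < u ->
  {for t, continuous h} ->
  derivable (fun s => C + primitive h s) t 1 /\
  derive1 (fun s => C + primitive h s) t = h t.
Proof.
move=> hu t0 tu ct.
have hio : mu.-integrable `]0, u[ (EFin \o h).
  apply/(integrable_mkcond _ _) => //; move: hu; apply: eq_integrable => // x _ /=.
  by rewrite patchE mem_setE in_itv/=; case: ifP.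
(* The fundamental theorem is applied on an interval closed at its right end, while integrability is
   known on []0, u[]; the midpoint lies strictly between [t] and [u]. *)
pose w := (t + u) / 2.
have tw : t < w by rewrite /w; lra.
have hi : mu.-integrable `]0, w] (EFin \o h).
  apply: (integrableS _ _ _ hio) => // x /=; rewrite !in_itv/= /w.
  by move=> /andP[-> xw]; lra.
have [dF F't] := continuous_FTC1 (a := BRight 0) tw hi t0 ct.
pose P (s : R) : R := \int[mu]_(x in `]0, s]) h x.
have Fnear : {near t, (fun s => C + P s) =1
                      (fun s => C + primitive h s)}.
  have tw' : \forall s \near t, s < w by exact: lt_nbhsl.
  apply: filterS tw' => s sw; congr (_ + _).
  rewrite /P /primitive -Rintegral_itv_if Rintegral_itv_bndo_bndc//.
  apply: (integrableS _ _ _ hi) => // x /=; rewrite !in_itv/=.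
  by move=> /andP[-> /ltW xs]; rewrite (le_trans xs (ltW sw)).
have dCF : derivable (fun s => C + P s) t 1.
  by apply: derivableD; [exact: derivable_cst|exact: dF].
split; first exact: near_eq_derivable Fnear dCF.
rewrite derive1E -(near_eq_derive _ Fnear) deriveD//.
by rewrite derive_cst add0r -derive1E.
Qed.

End primitives.

(** * Linear growth of the nonlinearity *)

Section linear_growth.
Context {R : realType}.

(** A positive [k < K] gives [omega r <= r / k] for [r >= T]; below [T], monotonicity bounds
    [omega r] by [omega T]. *)
Lemma omega_linear_growth (omega : R -> R) (K : \bar R) : (0 < K)%E ->
  (forall t, 0 <= t -> 0 <= omega t) ->
  (forall s t, 0 <= s -> s <= t -> omega s <= omega t) ->
  (t%:E / (omega t)%:E)%E @[t --> +oo%R] --> K ->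
  exists2 C : R, 0 < C & forall r, 0 <= r -> omega r <= C * (1 + r).
Proof.
move=> K0 omega0 omega_nd omega_lim.
have [k k0 kK] : exists2 k : R, 0 < k & (k%:E < K)%E.
  case: K K0 {omega_lim} => [K| |]// K0; last by exists 1; rewrite ?ltry.
  by exists (K / 2); rewrite ?lte_fin; move: K0; rewrite lte_fin => K0; lra.
have [M [_ kM]] := omega_lim _ (open_ereal_gt' kK).
pose T := Num.max M 0 + 1.
have maxM : M <= Num.max M 0 by rewrite le_max lexx.
have max0 : 0 <= Num.max M 0 by rewrite le_max lexx orbT.
have T0 : 0 < T by rewrite /T; lra.
have omegaT r : T <= r -> omega r <= r / k.
  move=> Tr; have r0 : 0 <= r by lra.
  have Mr : M < r by rewrite /T in Tr; lra.
  (* Where [omega r = 0], its extended-real inverse is [+oo] and the limit gives no information, but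
     the bound is trivial. *)
  have := kM r Mr; rewrite /= inver; case: ifPn => [/eqP ->|w0].
    by rewrite divr_ge0// ltW.
  have w_gt0 : 0 < omega r by rewrite lt_def w0 omega0.
  rewrite -EFinM lte_fin ltr_pdivlMr// => kw.
  by rewrite ler_pdivlMr// mulrC ltW.
exists ((T + 1) / k); first by rewrite divr_gt0//; lra.
move=> r r0; have k1 : 0 < k^-1 by rewrite invr_gt0.
have [Tr|rT] := leP T r.
  rewrite (le_trans (omegaT r Tr))// mulrAC ler_pM2r//; nra.
rewrite (le_trans (omega_nd r T r0 (ltW rT)))//.
rewrite (le_trans (omegaT T (lexx T)))// mulrAC ler_pM2r//; nra.
Qed.

End linear_growth.

(** * The equation for [u(t) = t^a x(t)] *)

Section regularized_equation.
Context {R : realType}.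
Notation mu := (@lebesgue_measure R).
Notation integrable f := (mu.-integrable setT (EFin \o f)).

(* The right-hand side in terms of [u t = t `^ a * x t]. *)
Definition regularized_rhs (a c : R) (f : R -> R -> R) (s v : R) : R :=
  if 0 < s then c * f s (s `^ (- a) * v) else 0.

Lemma measurable_if_gt0 (h : R -> R) : (forall s : R, 0 < s -> {for s, continuous h}) ->
  measurable_fun setT (fun s : R => if 0 < s then h s else 0).
Proof.
move=> ch.
have mh : measurable_fun (`]0, +oo[%classic : set R) h.
  apply: open_continuous_measurable_fun; first exact: interval_open.
  by move=> s; rewrite inE/= in_itv/= andbT => s0; exact: ch.
have := (measurable_restrictT _ _).1 mh.
rewrite (_ : _ \_ _ = (fun s : R => if 0 < s then h s else 0)).
  by apply; exact: measurable_itv.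
by apply/funext => s; rewrite patchE mem_setE in_itv/= andbT.
Qed.

Section rhs.
Context (a c : R) (f : R -> R -> R).
Hypothesis f_cont : {within [set z : R * R | 0 < z.1], continuous (fun z => f z.1 z.2)}.

Lemma rhs_continuous2 (s v : R) : 0 < s ->
  {for (s, v), continuous (fun z : R * R => f z.1 z.2)}.
Proof.
have o : open [set z : R * R | 0 < z.1].
  have -> : [set z : R * R | 0 < z.1] = (fst : R * R -> R) @^-1` [set r | 0 < r] by [].
  by apply: open_comp; [move=> z _; exact: cvg_fst|exact: open_gt].
move=> s0; move: f_cont; rewrite continuous_open_subspace// => fc.
by apply: fc; rewrite inE.
Qed.

Lemma rhs_continuous_comp (u : R -> R) (s : R) : 0 < s -> {for s, continuous u} ->
  {for s, continuous (fun s => f s (s `^ (- a) * u s))}.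
Proof.
move=> s0 cu.
apply: (@continuous_comp _ _ _ (fun s : R => (s, s `^ (- a) * u s))
  (fun z : R * R => f z.1 z.2)); last exact: rhs_continuous2.
have c2 : s' `^ (- a) * u s' @[s' --> s] --> s `^ (- a) * u s.
  by apply: cvgM; [exact: continuous_powR_gt0|exact: cu].
exact: (@cvg_pair _ _ _ (nbhs s) (nbhs s) (nbhs (s `^ (- a) * u s)) _ _ _ id
  (fun s' => s' `^ (- a) * u s') cvg_id c2).
Qed.

Lemma regularized_rhs_continuous (s : R) : continuous (regularized_rhs a c f s).
Proof.
rewrite /regularized_rhs; have [s0 v|s0 v] := ltP 0 s; last exact: cvg_cst.
apply: cvgM; first exact: cvg_cst.
apply: (@continuous_comp _ _ _ (fun v : R => (s, s `^ (- a) * v))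
  (fun z : R * R => f z.1 z.2)); last exact: rhs_continuous2.
have c2 : s `^ (- a) * v' @[v' --> v] --> s `^ (- a) * v.
  by apply: cvgM; [exact: cvg_cst|exact: cvg_id].
exact: (@cvg_pair _ _ _ (nbhs v) (nbhs s) (nbhs (s `^ (- a) * v)) _ _ _ (cst s)
  (fun v' => s `^ (- a) * v') (cvg_cst _) c2).
Qed.

Lemma measurable_regularized_rhs (u : R -> R) : continuous u ->
  measurable_fun setT (fun s : R => regularized_rhs a c f s (u s)).
Proof.
move=> cu; apply: (@measurable_if_gt0 (fun s => c * f s (s `^ (- a) * u s))).
move=> s s0; apply: cvgM; first exact: cvg_cst.
by apply: rhs_continuous_comp => //; exact: cu.
Qed.

End rhs.

(** The hypotheses of [volterra_solution] are checked with [L = c * C * l] on the positive axis: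
    [s^a L] inherits local p-integrability from [l], and linear growth gives [F_bound]. *)
Lemma regularized_solution (a p q c C x0 : R) (f : R -> R -> R) (l : R -> R) :
  0 < a -> 1 <= p -> 0 < q -> p^-1 + q^-1 = 1 -> a * q < 1 -> 0 < c -> 0 < C ->
  {within [set z : R * R | 0 < z.1], continuous (fun z => f z.1 z.2)} ->
  {within `]0, +oo[, continuous l} ->
  (forall t : R, 0 < t -> 0 <= l t) ->
  Lp_loc p (fun t => t `^ a * l t) ->
  (forall t x : R, 0 < t -> `|f t x| <= l t * (C * (1 + t `^ a * `|x|))) ->
  exists u : R -> R,
  [/\ continuous u,
      forall t : R, integrable (fun s : R => weighted_kernel a t s * regularized_rhs a c f s (u s)),
      forall T : R, integrable (fun s : R =>
        if 0 < s < T then regularized_rhs a c f s (u s) else 0) &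
      forall t : R, u t = x0 +
        volterra_op (weighted_kernel a) (fun s => regularized_rhs a c f s (u s)) t].
Proof.
move=> a0 p1 q0 pq aq c0 C0 f_cont l_cont l_ge0 l_Lp f_le.
have p0 : 0 < p by lra.
pose M := c * C; have M0 : 0 < M by rewrite mulr_gt0.
pose L (s : R) : R := if 0 < s then M * l s else 0.
have L_meas : measurable_fun setT L.
  apply: (@measurable_if_gt0 (fun s => M * l s)) => s s0.
  apply: cvgM; first exact: cvg_cst.
  move: l_cont; rewrite continuous_open_subspace; last exact: interval_open.
  by apply; rewrite inE/= in_itv/= s0.
have L_ge0 s : 0 <= L s.
  by rewrite /L; case: ifP => // s0; rewrite mulr_ge0 ?(ltW M0)// l_ge0.
have L_le0 s : s <= 0 -> L s = 0 by move=> s0; rewrite /L ltNge s0.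
have H_int T : integrable (fun s : R => if s <= T then (s `^ a * L s) `^ p else 0).
  (* [Lp_loc] speaks of positive bounds only, whereas [T] is arbitrary here. *)
  have T'0 : 0 < `|T| + 1 by rewrite ltr_wpDl.
  have := Lfun_integrable p1 (l_Lp _ T'0).
  set g := _ \_ _ => g_int.
  apply: (@dominated_integrable_real _ _ (fun s : R => M `^ p * (`|g s| `^ p))).
  - apply: measurable_fun_ifT => //; first exact: measurable_fun_ler.
    apply: (@measurableT_comp _ _ _ _ _ _ (fun x : R => x `^ p)).
      exact: measurable_powR.
    by apply: measurable_funM => //; exact: measurable_powR.
  - move=> s; have rhs0 : 0 <= M `^ p * (`|g s| `^ p) by rewrite mulr_ge0 ?powR_ge0.
    case: ifPn => [sT|_]; last by rewrite normr0.
    rewrite ger0_norm ?powR_ge0//; have [s0|s0] := leP s 0.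
      by rewrite L_le0// mulr0 powR0// gt_eqF.
    have -> : g s = s `^ a * l s.
      rewrite /g patchE mem_set//= in_itv/= (ltW s0)/=.
      by rewrite (le_trans sT)// (le_trans (ler_norm _))// lerDl.
    have la : 0 <= s `^ a * l s by rewrite mulr_ge0 ?powR_ge0// l_ge0.
    by rewrite (ger0_norm la) -powRM ?(ltW M0)// /L s0 mulrCA.
  - exact: integrableZl_real.
have L_int := L_integrable a0 p0 q0 pq aq L_meas L_ge0 L_le0 H_int.
have kL_int := weighted_kernel_integrable a0 p0 q0 pq aq L_meas L_ge0 L_le0 H_int.
have F_bound s v : `|regularized_rhs a c f s v| <= L s * (1 + `|v|).
  rewrite /regularized_rhs /L; case: ifPn => [s0|_]; last by rewrite normr0 mul0r.
  rewrite normrM (gtr0_norm c0) /M -!mulrA ler_pM2l// mulrCA.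
  rewrite (le_trans (f_le _ _ s0))// (_ : s `^ a * `|s `^ (- a) * v| = `|v|)//.
  rewrite normrM (ger0_norm (powR_ge0 _ _)) mulrA.
  by rewrite -powRD ?subrr ?powRr0 ?mul1r// (gt_eqF s0) implybT.
have F_meas := @measurable_regularized_rhs a c f f_cont.
have [|u [cu bu uE]] := @volterra_solution R (weighted_kernel a) L
  (weighted_kernel_ge0 a) (@weighted_kernel_out _ a) (measurable_weighted_kernel a)
  (fun T eta => weighted_kernel_bounded T a0)
  (fun t0 s => @weighted_kernel_cvg _ a t0 s) L_ge0 L_int L_meas kL_int _
  (regularized_rhs a c f) x0 (@regularized_rhs_continuous a c f f_cont) F_meas F_bound.
  move=> T e e0.
  have [eta eta0 tailP] := weighted_kernel_tail a0 p0 q0 pq aq L_meas L_ge0 L_le0 H_int T e0.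
  by exists eta => // t tT; have [] := tailP t tT.
have Fu T : exists D : R, forall s, s <= T ->
    `|regularized_rhs a c f s (u s)| <= D * L s.
  have [D uD] := bu T; exists (1 + D) => s sT.
  by rewrite (le_trans (F_bound _ _))// mulrC ler_wpM2r// lerD2l uD.
exists u; split => //.
- move=> t; have [D FD] := Fu t.
  by apply: (kg_int (weighted_kernel_ge0 a) (@weighted_kernel_out _ a)
    (measurable_weighted_kernel a) kL_int (F_meas _ cu) FD).
- move=> T; have [D FD] := Fu T.
  apply: (@dominated_integrable_real _ _ (fun s : R => `|D| * (if s <= T then L s else 0))).
  + by apply: measurable_fun_itv_if; exact: F_meas.
  + move=> s; case: ifPn => [/andP[s0 sT]|_].
      rewrite (ltW sT) (le_trans (FD _ (ltW sT)))//.
      by rewrite ler_wpM2r// ler_norm.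
    by rewrite normr0 mulr_ge0//; case: ifP.
  + exact: integrableZl_real.
Qed.

End regularized_equation.

(** * The fractional integral of a solution *)

Section riemann_liouville.
Context {R : realType}.
Notation mu := (@lebesgue_measure R).
Notation integrable f := (mu.-integrable setT (EFin \o f)).

Lemma weighted_kernelE (a t s : R) : weighted_kernel a t s = t `^ a * abel_kernel a t s.
Proof. by rewrite /weighted_kernel /abel_kernel; case: ifP; rewrite ?mulr0. Qed.

Lemma abel_kernelE (a t s : R) : abel_kernel a t s = t `^ (- a) * weighted_kernel a t s.
Proof.
rewrite /weighted_kernel /abel_kernel; case: ifP; rewrite ?mulr0// => /andP[s0 st].
rewrite mulrA -powRD ?addNr ?powRr0 ?mul1r//.
by rewrite (gt_eqF (lt_trans s0 st)) implybT.
Qed.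

(** Dividing the Volterra equation by [s^a] leaves [x0 * s^(-a)] plus an Abel integral of [G]. The
    first integrates to a constant, the second reduces to a primitive by [abel_composition]. *)
Lemma RL_integral_solution (a b x0 t : R) (G u : R -> R) :
  0 < a < 1 -> 0 < b < 1 -> a + b = 1 -> measurable_fun setT G ->
  (forall t, integrable (fun s => weighted_kernel a t s * G s)) ->
  (forall T, integrable (fun s => if 0 < s < T then G s else 0)) ->
  (forall t, u t = x0 + volterra_op (weighted_kernel a) G t) -> 0 < t ->
  RL_integral a (fun s => s `^ (- a) * u s) t =
  (Gamma a)^-1 * (beta_integral a b * x0 + beta_integral a b * primitive G t).
Proof.
move=> a01 b01 ab mG kG G_int uE t0; rewrite /RL_integral; congr (_ * _).
move/andP: (a01) => [a0 a1].
have abel_int s : integrable (fun r => abel_kernel a s r * G r).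
  have := integrableZl_real (s `^ (- a)) (kG s); apply: eq_integrable => // r _ /=.
  by rewrite abel_kernelE mulrA.
have [pow_int powE] := integrable_abel_kernel_powR a01 b01 ab t0.
have [comp_int compE] := abel_composition a01 b01 ab mG abel_int (G_int t).
rewrite /primitive -compE -powE mulrC -RintegralZl// -RintegralD//; last exact: integrableZl_real.
rewrite Rintegral_mkcond; apply: eq_Rintegral => s _.
rewrite patchE mem_setE in_itv/=.
have -> : 1 - a = b by rewrite -ab; ring.
have [st|] := boolP (0 < s < t).
  have abelE : abel_kernel b t s = (t - s) `^ (- b) by rewrite /abel_kernel st.
  move/andP: st => [s0 st]; rewrite (ltW s0) (ltW st)/= uE /volterra_op.
  under eq_Rintegral do rewrite weighted_kernelE -mulrA.
  rewrite RintegralZl// abelE (powRN (t - s)).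
  have sa : s `^ (- a) * s `^ a = 1.
    by rewrite -powRD ?addNr ?powRr0// (gt_eqF s0) implybT.
  set J := \int[mu]_r _; move: sa; set X := s `^ (- a); set Y := s `^ a => sa.
  have -> : X * (x0 + Y * J) = X * x0 + (X * Y) * J by ring.
  by rewrite sa; ring.
(* At the endpoints [s = 0] and [s = t] the integrand of [RL_integral] is also 0, because a nonzero
   power of 0 is 0 and so is the inverse of 0. *)
move=> nst; have -> : abel_kernel b t s = 0 by rewrite /abel_kernel (negbTE nst).
rewrite !mul0r mulr0 addr0; case: ifPn => // /andP[s0 st].
have [s_eq0|s_neq0] := eqVneq s 0.
  by rewrite s_eq0 powR0 ?mul0r// oppr_eq0 gt_eqF.
have s_gt0 : 0 < s by rewrite lt_def s_neq0.
have -> : s = t by apply/eqP; rewrite eq_le st/= leNgt; move: nst; rewrite s_gt0.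
by rewrite subrr powR0 ?invr0 ?mulr0// gt_eqF//; move/andP: b01 => [].
Qed.

End riemann_liouville.

(** * Existence of a global solution in the weighted space *)

Theorem theorem3p7 (R : realType) (beta x0 p q : R)
    (hbeta : 0 < beta < 1) (hp : p > beta^-1) (hq : q = p / (p - 1))
    (f : R -> R -> R)
    (hf : {within [set z : R * R | 0 < z.1], continuous (fun z => f z.1 z.2)})
    (l : R -> R)
    (hl_cont : {within `]0, +oo[, continuous l})
    (hl_ge0 : forall t : R, 0 < t -> 0 <= l t)
    (hl_Lp : Lp_loc p (fun t => t `^ (1 - beta) * l t))
    (omega : R -> R)
    (homega_cont : {within `[0, +oo[, continuous omega})
    (homega_ge0 : forall t : R, 0 <= t -> 0 <= omega t)
    (homega_nd : forall s t : R, 0 <= s -> s <= t -> omega s <= omega t)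
    (K : \bar R) (hK : (0 < K)%E)
    (homega_lim : (t%:E / (omega t)%:E)%E @[t --> +oo%R] --> K)
    (hfl : forall t x : R, 0 < t ->
       `|f t x| <= l t * omega (t `^ (1 - beta) * `|x|)) :
  exists x : R -> R, global_solution beta x0 f x.
Proof.
move/andP: (hbeta) => [beta0 beta1].
set a := 1 - beta in hl_Lp hfl *.
have a01 : 0 < a < 1 by apply/andP; split; rewrite /a; lra.
move/andP: (a01) => [a0 a1]; have ab : a + beta = 1 by rewrite /a subrK.
have p1 : 1 < p by rewrite (lt_trans _ hp)// invf_gt1.
have bp : 1 < beta * p by rewrite mulrC -ltr_pdivrMr// mul1r.
have q0 : 0 < q by rewrite hq divr_gt0//; lra.
have pq : p^-1 + q^-1 = 1 by rewrite hq; field; lra.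
(* Equivalent to [beta * p > 1], that is, to the assumption on [p]. *)
have aq : a * q < 1 by rewrite hq mulrA ltr_pdivrMr ?subr_gt0// mul1r /a; lra.
have [C C0 omegaC] := omega_linear_growth hK homega_ge0 homega_nd homega_lim.
have f_le t x : 0 < t -> `|f t x| <= l t * (C * (1 + t `^ a * `|x|)).
  move=> t0; rewrite (le_trans (hfl t x t0))// ler_wpM2l ?hl_ge0// omegaC//.
  by rewrite mulr_ge0 ?powR_ge0.
have B0 := beta_integral_gt0 a01 hbeta; have G0 := Gamma_gt0 a01.
(* This choice turns the factor of the primitive in [RL_integral_solution] into 1, once [G = c * g]
   on the positive axis. *)
pose c := Gamma a / beta_integral a beta; have c0 : 0 < c by rewrite divr_gt0.
have [u [cu kG_int G_int uE]] := regularized_solution x0 a0 (ltW p1) q0 pq aq c0 C0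
  hf hl_cont hl_ge0 hl_Lp f_le.
pose x s := s `^ (- a) * u s.
pose G s := regularized_rhs a c f s (u s).
have mG : measurable_fun setT G by exact: measurable_regularized_rhs.
pose g s := f s (x s).
pose C1 := (Gamma a)^-1 * (beta_integral a beta * x0).
have g_int T : (@lebesgue_measure R).-integrable setT
    (EFin \o (fun s : R => if 0 < s < T then g s else 0)).
  have := integrableZl_real c^-1 (G_int T); apply: eq_integrable => // s _ /=.
  congr EFin; case: ifP; rewrite ?mulr0// => /andP[s0 _].
  by rewrite /regularized_rhs s0 mulKf// gt_eqF.
have RLE t : 0 < t -> RL_integral a x t = C1 + primitive g t.
  move=> t0; rewrite (RL_integral_solution a01 hbeta ab mG kG_int G_int uE t0).
  rewrite mulrDr; congr (_ + _).
  have -> : primitive G t = c * primitive g t.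
    rewrite /primitive -RintegralZl//; apply: eq_Rintegral => s _.
    case: ifP; rewrite ?mulr0// => /andP[s0 _].
    by rewrite /G /regularized_rhs s0.
  by rewrite /c; field; rewrite !gt_eqF.
(* The initial condition is continuity of [u] at 0, where the integral term vanishes. *)
have u0 : u 0 = x0.
  by rewrite uE (volterra_op_le0 (@weighted_kernel_out _ a)) ?addr0.
have x_lim : t `^ a * x t @[t --> 0^'+] --> x0.
  have : u t @[t --> 0^'+] --> x0 by rewrite -u0; apply: cvg_at_right_filter; exact: cu.
  apply: cvg_trans; apply: near_eq_cvg; near=> t.
  have t0 : 0 < t by near: t; exact: nbhs_right_gt.
  by rewrite /x mulrA -powRD ?subrr ?powRr0 ?mul1r// (gt_eqF t0) implybT.
exists x; split=> //.
- split; last by exists x0.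
  apply: continuous_in_subspaceT => t; rewrite inE/= in_itv/= andbT => t0.
  by apply: cvgM; [exact: continuous_powR_gt0|exact: cu].
- move=> T T0; split.
    exists (fun t => C1 + primitive g t).
      exact: primitive_absolutely_continuous.
    by move=> t /andP[t0 _]; exact: RLE.
  (* The exceptional set is empty: [g] is continuous on the positive axis, so the equation holds at
     every [t > 0]. *)
  exists set0; split=> // t /= nP; apply: nP => /andP[t0 tT].
  have RLnear : {near t, (fun s => C1 + primitive g s) =1 RL_integral a x}.
    have t0' : \forall s \near t, 0 < s by exact: lt_nbhsr.
    by apply: filterS t0' => s s0; rewrite RLE.
  have tT1 : t < T + 1 by lra.
  have cg : {for t, continuous g}.
    by apply: rhs_continuous_comp => //; exact: cu.
  have [dg g't] := primitive_derivable C1 (g_int (T + 1)) t0 tT1 cg.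
  split; first exact: near_eq_derivable RLnear dg.
  by rewrite /RL_derivative derive1E -(near_eq_derive _ RLnear) -derive1E.
Unshelve. all: end_near. Qed.
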